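(* Let $\mathscr{M}=\{m_n\}_{n\in\mathbb{N}_0}$ be a weight sequence and $N\ge1$. Let $\{b_\xi\}_{\xi\in\mathbb{Z}^N}$ be a sequence of complex numbers and suppose there exist $C,\delta>0$ such that $$|b_\xi|\le C\cdot\inf_{n\in\mathbb{N}_0}\left(\frac{m_n\cdot n!}{\delta^n(1+|\xi|)^n}\right),\qquad\forall\xi\in\mathbb{Z}^N.$$ Then there exists $\psi\in\mathcal{E}_{\mathscr{M}}(\mathbb{T}^N)$ such that $$\psi(x)=\sum_{\xi\in\mathbb{Z}^N}b_\xi e^{ix\xi},$$ with convergence in $\mathcal{E}_{\mathscr{M}}(\mathbb{T}^N)$. In addition, $\widehat\psi(\xi)=b_\xi$ for every $\xi\in\mathbb{Z}^N$.
   Context: $\mathbb{N}=\{1,2,\dots\}$, $\mathbb{N}_0=\mathbb{N}\cup\{0\}$, $\mathbb{T}^N=\mathbb{R}^N/2\pi\mathbb{Z}^N$, and $|\xi|$ is the Euclidean norm of $\xi\in\mathbb{Z}^N$. A weight sequence is a sequence $\mathscr{M}=\{m_n\}_{n\in\mathbb{N}_0}$ of positive reals with: $m_0=m_1=1$; $m_n^2\le m_{n-1}m_{n+1}$ for all $n\in\mathbb{N}$; and there is $H>1$ with $m_{j+k}\le H^{j+k}m_jm_k$ for all $j,k\in\mathbb{N}_0$. $\mathcal{E}_{\mathscr{M}}(\mathbb{T}^N)$ is the space of $f\in C^\infty(\mathbb{T}^N)$ (complex-valued) for which there are $C,h>0$ with $|D^\alpha f(x)|\le C h^{|\alpha|}m_{|\alpha|}|\alpha|!$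 for all $x\in\mathbb{T}^N$, $\alpha\in\mathbb{N}_0^N$, where $D=-i\partial$. For $h>0$, $\mathcal{E}_{\mathscr{M},h}(\mathbb{T}^N)$ is the Banach space of those $f$ with $\|f\|_{\mathscr{M},h}:=\sup_{x,\alpha}\frac{|D^\alpha f(x)|}{h^{|\alpha|}m_{|\alpha|}|\alpha|!}<\infty$. $\mathcal{E}_{\mathscr{M}}(\mathbb{T}^N)$ carries the locally convex inductive limit topology of the spaces $\mathcal{E}_{\mathscr{M},h_n}(\mathbb{T}^N)$ for any strictly increasing positive sequence $h_n\to+\infty$ (the topology does not depend on the choice). Fourier coefficients: $\widehat\psi(\xi)=\frac{1}{(2\pi)^N}\int_{\mathbb{T}^N}e^{-ix\xi}\psi(x)\,dx$. Convergence of a series over $\mathbb{Z}^N$ means convergence of the partial sums over $|\xi|\le j$ as $j\to\infty$. *)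

(* Defs.v *)
From HB Require Import structures.
From mathcomp Require Import all_boot all_order all_algebra.
From mathcomp Require Import complex lra.
From mathcomp Require Import all_classical all_reals all_analysis.

Set Implicit Arguments.
Unset Strict Implicit.
Unset Printing Implicit Defensive.

Import Order.TTheory GRing.Theory Num.Theory.
Import numFieldNormedType.Exports.
Import ComplexField.Normc.

Local Open Scope classical_set_scope.
Local Open Scope ring_scope.
Local Open Scope complex_scope.

Record weight_sequence (R : realType) : Type := WeightSequence {
  ws_val :> nat -> R;
  ws_gt0 : forall n, 0 < ws_val n;
  ws_0 : ws_val 0 = 1;
  ws_1 : ws_val 1 = 1;
  ws_logconvex : forall n, (0 < n)%N ->
    ws_val n ^+ 2 <= ws_val n.-1 * ws_val n.+1;
  ws_stable : exists2 H : R, 1 < H &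
    forall j k, ws_val (j + k)%N <= H ^+ (j + k)%N * ws_val j * ws_val k }.

(* Functions on the torus R^N / 2 pi Z^N are the functions on R^N that are     *)
(* 2 pi-periodic in each coordinate.  Continuity and differentiability of a    *)
(* complex-valued function are those of its real and imaginary parts.          *)
Section smooth_functions.
Variables (R : realType) (N : nat).
Local Notation F := ('rV[R]_N -> R[i]).
Implicit Types (f g : F) (j : 'I_N) (x : 'rV[R]_N).

Definition periodic f : Prop :=
  forall x j, f (x + (2 * pi) *: delta_mx 0 j) = f x.

Definition re_part f : 'rV[R]_N -> R := fun x => complex.Re (f x).
Definition im_part f : 'rV[R]_N -> R := fun x => complex.Im (f x).

Definition partial j f : F := fun x =>
  'D_(delta_mx 0 j) (re_part f) x +i* 'D_(delta_mx 0 j) (im_part f) x.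

Definition continuousC f : Prop :=
  continuous (re_part f) /\ continuous (im_part f).

Definition has_partials f : Prop :=
  forall x j, derivable (re_part f) x (delta_mx 0 j) /\
              derivable (im_part f) x (delta_mx 0 j).

(* [foldr partial f s] is the iterated partial derivative of [f] in the        *)
(* directions listed in [s].                                                   *)
Definition smooth f : Prop :=
  forall s : seq 'I_N,
    continuousC (foldr partial f s) /\ has_partials (foldr partial f s).

Definition mindex : Type := {ffun 'I_N -> nat}.

Definition mdeg (a : mindex) : nat := (\sum_(j < N) a j)%N.

Definition Dop j f : F := fun x => - (0 +i* 1) * partial j f x.

Definition Dmulti (a : mindex) f : F :=
  foldr (fun j g => iter (a j) (Dop j) g) f (enum 'I_N).

Lemma re_part_lin (c : R[i]) f g :
  re_part (c *: f + g) =
  complex.Re c *: re_part f + (- complex.Im c) *: im_part f + re_part g.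
Proof.
apply/funext => x; rewrite /re_part /im_part !fctE /=.
rewrite /GRing.scale /=.
by case: c => a b; case: (f x) => u v; case: (g x) => u' v' /=; rewrite mulNr.
Qed.

Lemma im_part_lin (c : R[i]) f g :
  im_part (c *: f + g) =
  complex.Re c *: im_part f + complex.Im c *: re_part f + im_part g.
Proof.
apply/funext => x; rewrite /re_part /im_part !fctE /=.
rewrite /GRing.scale /=.
by case: c => a b; case: (f x) => u v; case: (g x) => u' v' /=.
Qed.

Lemma continuousC_lin c f g :
  continuousC f -> continuousC g -> continuousC (c *: f + g).
Proof.
move=> [cf cf'] [cg cg']; split; rewrite ?re_part_lin ?im_part_lin => x.
  by apply: cvgD (cg x); apply: cvgD; apply: cvgZr; [exact: cf|exact: cf'].
by apply: cvgD (cg' x); apply: cvgD; apply: cvgZr; [exact: cf'|exact: cf].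
Qed.

Lemma has_partials_lin c f g :
  has_partials f -> has_partials g -> has_partials (c *: f + g).
Proof.
move=> df dg x j; have [df1 df2] := df x j; have [dg1 dg2] := dg x j.
rewrite re_part_lin im_part_lin; split.
  by apply: (derivableD _ dg1); apply: derivableD; exact: derivableZ.
by apply: (derivableD _ dg2); apply: derivableD; exact: derivableZ.
Qed.

Lemma partial_lin j c f g : has_partials f -> has_partials g ->
  partial j (c *: f + g) = c *: partial j f + partial j g.
Proof.
move=> df dg; apply/funext => x.
have [df1 df2] := df x j; have [dg1 dg2] := dg x j.
have dL (u v : R) (p q r : 'rV[R]_N -> R) : derivable p x (delta_mx 0 j) ->
    derivable q x (delta_mx 0 j) -> derivable r x (delta_mx 0 j) ->
    'D_(delta_mx 0 j) (u *: p + v *: q + r) x = u * 'D_(delta_mx 0 j) p x +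
      v * 'D_(delta_mx 0 j) q x + 'D_(delta_mx 0 j) r x.
  move=> dp dq dr; have dup := derivableZ (k := u) dp.
  have dvq := derivableZ (k := v) dq.
  by rewrite (deriveD (derivableD dup dvq) dr) (deriveD dup dvq) !deriveZ.
rewrite /partial re_part_lin im_part_lin !dL// !fctE /GRing.scale /=.
by case: c => a b /=; rewrite mulNr.
Qed.

Lemma smooth_partial j f : smooth f -> smooth (partial j f).
Proof. by move=> sf s; have := sf (rcons s j); rewrite foldr_rcons. Qed.

Lemma foldr_partial_lin c f g s : smooth f -> smooth g ->
  foldr partial (c *: f + g) s = c *: foldr partial f s + foldr partial g s.
Proof.
move=> sf sg; elim: s => [//|j s IH] /=.
by rewrite IH partial_lin//; [exact: (sf s).2|exact: (sg s).2].
Qed.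

Lemma smooth_lin c f g : smooth f -> smooth g -> smooth (c *: f + g).
Proof.
move=> sf sg s; rewrite foldr_partial_lin//.
have [[? ?] [? ?]] := (sf s, sg s).
by split; [exact: continuousC_lin|exact: has_partials_lin].
Qed.

Lemma smooth0 : smooth 0.
Proof.
have re0 : re_part 0 = cst 0 by apply/funext.
have im0 : im_part 0 = cst 0 by apply/funext.
have p0 j : partial j 0 = 0.
  by apply/funext => x; rewrite /partial re0 im0 !derive_cst.
move=> s; suff -> : foldr partial 0 s = 0.
  split; first by split; rewrite ?re0 ?im0; exact: cst_continuous.
  by move=> x j; rewrite re0 im0; split; exact: derivable_cst.
by elim: s => //= j s ->.
Qed.

Lemma smoothZ c f : smooth f -> smooth (c *: f).
Proof. by move=> sf; rewrite -[_ *: _]addr0; exact: smooth_lin smooth0. Qed.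

Lemma DopE j f : Dop j f = - (0 +i* 1) *: partial j f.
Proof. by []. Qed.

Lemma smooth_Dop j f : smooth f -> smooth (Dop j f).
Proof. by move=> sf; rewrite DopE; exact/smoothZ/smooth_partial. Qed.

Lemma Dop_lin j c f g : smooth f -> smooth g ->
  Dop j (c *: f + g) = c *: Dop j f + Dop j g.
Proof.
move=> sf sg; rewrite !DopE partial_lin; [|exact: (sf [::]).2|exact: (sg [::]).2].
by rewrite scalerDr !scalerA mulrC.
Qed.

Lemma Dmulti_lin a c f g : smooth f -> smooth g ->
  Dmulti a (c *: f + g) = c *: Dmulti a f + Dmulti a g.
Proof.
move=> sf sg; rewrite /Dmulti.
suff [] : let D := fun h => foldr (fun j k => iter (a j) (Dop j) k) h (enum 'I_N)
  in [/\ smooth (D f), smooth (D g) & D (c *: f + g) = c *: D f + D g] by [].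
elim: (enum 'I_N) => [|j s] /=; first by split.
move=> [+ + ->]; move: (foldr _ f _) (foldr _ g _) => {f sf} f {g sg} g sf sg.
elim: (a j) => [|n [sDf sDg E]]; first by split.
by split; rewrite /= ?E; [exact: smooth_Dop|exact: smooth_Dop|exact: Dop_lin].
Qed.

Lemma periodic_lin (c : R[i]) f g :
  periodic f -> periodic g -> periodic (c *: f + g).
Proof. by move=> pf pg x j; rewrite !fctE pf pg. Qed.

End smooth_functions.

Section denjoy_carleman.
Variables (R : realType) (N : nat) (M : weight_sequence R).
Implicit Types (f : 'rV[R]_N -> R[i]).

(* The Denjoy-Carleman class of the weight sequence M.                         *)
Definition DC_class f : Prop :=
  [/\ periodic f, smooth f &
      exists C h : R, [/\ 0 < C, 0 < h & forall x (a : mindex N),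
        normc (Dmulti a f x) <= C * h ^+ mdeg a * M (mdeg a) * (mdeg a)`!%:R]].

Definition DC_pred : {pred 'rV[R]_N -> R[i]} := [pred f | `[< DC_class f >]].

Lemma normcD (u v : R[i]) : normc (u + v) <= normc u + normc v.
Proof. by rewrite -lecR rmorphD; exact: (ler_normD u v). Qed.

Lemma normc_ge0 (u : R[i]) : 0 <= normc u.
Proof. by case: u => a b; exact: sqrtr_ge0. Qed.

Lemma normc_real (t : R) : normc t%:C = `|t|.
Proof. by rewrite /= expr0n addr0 sqrtr_sqr. Qed.

Lemma DC_submod : submod_closed DC_pred.
Proof.
split.
  apply/asboolP; split; [by []|exact: smooth0|].
  exists 1, 1; split => // x a.
  have -> : Dmulti a 0 x = 0.
    have := @Dmulti_lin _ _ a (-1) _ _ (@smooth0 R N) (@smooth0 R N).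
    by rewrite scaler0 addr0 scaleN1r addNr => ->.
  by rewrite normc0 !mulr_ge0// ?exprn_ge0// ltW// ws_gt0.
move=> c f g /asboolP[pf sf [C1 [h1 [C10 h10 bf]]]].
move=> /asboolP[pg sg [C2 [h2 [C20 h20 bg]]]].
apply/asboolP; split; [exact: periodic_lin|exact: smooth_lin|].
exists (normc c * C1 + C2), (Num.max h1 h2); split.
- by rewrite ltr_wpDl// mulr_ge0 ?normc_ge0// ltW.
- by rewrite lt_max h10.
move=> x a; rewrite Dmulti_lin// fctE; apply: le_trans (normcD _ _) _.
rewrite normcM !mulrDl; apply: lerD.
  rewrite -!mulrA ler_wpM2l ?normc_ge0//; apply: le_trans (bf x a) _.
  rewrite -!mulrA ler_wpM2l ?(ltW C10)// ler_wpM2r//.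
    by rewrite mulr_ge0// ltW// ws_gt0.
  by rewrite lerXn2r ?nnegrE ?le_max ?lexx ?(ltW h10)//.
apply: le_trans (bg x a) _; rewrite -!mulrA ler_wpM2l ?(ltW C20)// ler_wpM2r//.
  by rewrite mulr_ge0// ltW// ws_gt0.
by rewrite lerXn2r ?nnegrE ?le_max ?lexx ?orbT ?(ltW h10) ?(ltW h20)//.
Qed.

HB.instance Definition _ :=
  GRing.isSubmodClosed.Build R[i] ('rV[R]_N -> R[i]) DC_pred DC_submod.

Record DC : Type := MkDC { DC_fun :> 'rV[R]_N -> R[i]; _ : DC_fun \in DC_pred }.

HB.instance Definition _ := [isSub for DC_fun].
HB.instance Definition _ := [Choice of DC by <:].
HB.instance Definition _ := [SubChoice_isSubLmodule of DC by <:].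

Implicit Types (u v w : DC) (U V : set DC).

Definition DC_norm (h : R) u : \bar R :=
  ereal_sup [set y | exists x (a : mindex N),
    y = (normc (Dmulti a u x) / (h ^+ mdeg a * M (mdeg a) * (mdeg a)`!%:R))%:E].

Definition DC_ball (h r : R) : set DC := [set u | (DC_norm h u < r%:E)%E].

Definition absolutely_convex V : Prop :=
  forall u v (a b : R[i]), V u -> V v -> normc a + normc b <= 1 ->
    V (a *: u + b *: v).

(* For 0 < h, the u with DC_norm h u < +oo form a Banach space E_h, whose      *)
(* balls around 0 are the [DC_ball h r].  [DC] is the union of the E_h and     *)
(* carries their locally convex inductive limit topology: a base of            *)
(* neighbourhoods of 0 is given by the absolutely convex sets whose trace on   *)
(* each E_h is a neighbourhood of 0 there.  The limit is taken over all h > 0; *)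
(* by [DC_nbhs0_seq] any sequence h_n -> +oo of positive reals gives the same  *)
(* base, and by [DC_nbhsE] the translates of this base generate the            *)
(* neighbourhoods of every point.                                              *)
Definition DC_nbhs0 V : Prop :=
  absolutely_convex V /\
  forall h : R, 0 < h -> exists2 r : R, 0 < r & DC_ball h r `<=` V.

Definition DC_open U : Prop :=
  forall u, U u -> exists2 V, DC_nbhs0 V & forall v, V (v - u) -> U v.

Lemma DC_openT : DC_open setT.
Proof.
move=> u _; exists setT => //; split; first by [].
by move=> h _; exists 1.
Qed.

Lemma DC_openI : setI_closed DC_open.
Proof.
move=> U1 U2 o1 o2 u [/o1[V1 [c1 b1] s1] /o2[V2 [c2 b2] s2]].
exists (V1 `&` V2); last by move=> v [? ?]; split; [exact: s1|exact: s2].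
split=> [v w a b [v1 v2] [w1 w2] ab|h h0].
  by split; [exact: c1|exact: c2].
have [r1 r10 B1] := b1 h h0; have [r2 r20 B2] := b2 h h0.
exists (Num.min r1 r2); first by rewrite lt_min r10.
rewrite /DC_ball => v /= vr.
split; [apply: B1|apply: B2]; apply: (lt_le_trans vr).
  by rewrite lee_fin ge_min lexx.
by rewrite lee_fin ge_min lexx orbT.
Qed.

Lemma DC_open_bigU (I : Type) (U : I -> set DC) :
  (forall i, DC_open (U i)) -> DC_open (\bigcup_i U i).
Proof.
move=> oU u [i _ /oU[V nV sV]]; exists V => // v /sV Uv.
by exists i.
Qed.

HB.instance Definition _ :=
  isOpenTopological.Build DC DC_openT DC_openI DC_open_bigU.

Lemma DC_normZ h c u : 0 < h -> (DC_norm h (c *: u) <= (normc c)%:E * DC_norm h u)%E.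
Proof.
move=> h0; apply: ge_ereal_sup => _ [x [a ->]].
have sm (w : DC) : smooth w by case: w => w /= /asboolP[].
have D0 : Dmulti a (0 : 'rV[R]_N -> R[i]) = 0.
    have := @Dmulti_lin _ _ a (-1) _ _ (@smooth0 R N) (@smooth0 R N).
    by rewrite scaler0 addr0 scaleN1r addNr.
have -> : Dmulti a (c *: u) x = c * Dmulti a u x.
  have := Dmulti_lin a c (sm u) (@smooth0 R N).
  by rewrite D0 !addr0 => /(congr1 (@^~ x)).
rewrite normcM -mulrA EFinM lee_wpmul2l ?lee_fin ?normc_ge0//.
by apply: ereal_sup_ubound; exists x, a.
Qed.

Lemma DC_norm_mono h h' u : 0 < h -> h <= h' -> (DC_norm h' u <= DC_norm h u)%E.
Proof.
move=> h0 hh'; apply: ge_ereal_sup => _ [x [a ->]].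
apply: le_trans (ereal_sup_ubound _); last by exists x, a.
have h'0 := lt_le_trans h0 hh'.
have f0 : 0 < (mdeg a)`!%:R :> R by rewrite ltr0n fact_gt0.
rewrite lee_fin ler_wpM2l ?normc_ge0// lef_pV2 ?posrE ?mulr_gt0 ?exprn_gt0 ?ws_gt0//.
rewrite !ler_wpM2r ?(ltW f0) ?(ltW (ws_gt0 _ _))//.
by rewrite lerXn2r ?nnegrE ?(ltW h0) ?(ltW h'0).
Qed.

Lemma DC_nbhs0_seq (hs : nat -> R) V :
  (forall n, 0 < hs n) -> hs @ \oo --> +oo ->
  DC_nbhs0 V <-> absolutely_convex V /\
    forall n, exists2 r : R, 0 < r & DC_ball (hs n) r `<=` V.
Proof.
move=> hs0 hsoo; split=> -[cV bV]; split=> //.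
  by move=> n; exact: bV.
move=> h h0.
have [n hn] : exists n, h <= hs n.
  by have /cvgryPge/(_ h)[n _ hn] := hsoo; exists n; exact: hn (leqnn n).
have [r r0 B] := bV n; exists r => // u hu; apply: B.
exact: le_lt_trans (DC_norm_mono _ h0 hn) hu.
Qed.

Lemma DC_nbhs0Z (t : R) V : 0 < t -> DC_nbhs0 V ->
  DC_nbhs0 [set u | V (t%:C *: u)].
Proof.
move=> t0 [cV bV]; split.
  move=> u v a b /= Vu Vv ab; rewrite scalerDr !scalerA ![t%:C * _]mulrC -!scalerA.
  exact: cV.
move=> h h0; have [r r0 B] := bV h h0.
exists (r / t); first exact: divr_gt0.
move=> u hu; apply: B; apply: le_lt_trans (DC_normZ _ _ h0) _.
have -> : normc t%:C = t by rewrite normc_real gtr0_norm.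
by rewrite muleC -lte_pdivlMr// -EFinM.
Qed.

Lemma DC_nbhsE u U :
  nbhs u U <-> exists2 V, DC_nbhs0 V & forall v, V (v - u) -> U v.
Proof.
split=> [|[V nV sV]].
  rewrite nbhsE => -[W [opW Wu] WU]; have [V nV VW] := opW u Wu.
  by exists V => // v /VW /WU.
have V0 : V 0.
  have [_ /(_ 1 ltr01)[r r0]] := nV; apply.
  have := DC_normZ 0 (0 : DC) (@ltr01 R).
  rewrite scaler0 normc0 mul0e => /le_lt_trans; apply.
  by rewrite lte_fin.
rewrite nbhsE.
exists [set v | exists2 t : R, 0 < t < 1 & V (t^-1%:C *: (v - u))]; last first.
  move=> v [t /andP[t0 t1] Vv]; apply: sV.
  have tle : normc t%:C + normc (0 : R[i]) <= 1.
    by rewrite normc_real normc0 addr0 gtr0_norm// ltW.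
  have := nV.1 _ _ _ _ Vv V0 tle; rewrite scaler0 addr0 scalerA -rmorphM.
  by rewrite mulfV ?gt_eqF// rmorph1 scale1r.
split; last first.
  by exists 2^-1; [rewrite invr_gt0 ltr0n invf_lt1 ?ltr1n|rewrite subrr scaler0].
move=> v [t /andP[t0 t1] Vv].
pose d := (1 - t) / 2.
have d0 : 0 < d by rewrite divr_gt0// subr_gt0.
exists [set w | V (d^-1%:C *: w)].
  by apply: DC_nbhs0Z => //; rewrite invr_gt0.
move=> w /= Vw.
have s0 : 0 < t + d by rewrite addr_gt0.
exists (t + d); first by rewrite s0 /= /d; lra.
have -> : (t + d)^-1%:C *: (w - u) =
    (t / (t + d))%:C *: (t^-1%:C *: (v - u)) +
    (d / (t + d))%:C *: (d^-1%:C *: (w - v)).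
  rewrite !scalerA -!rmorphM ![_ / (t + d) * _]mulrAC !mulfV ?gt_eqF// !mul1r.
  by rewrite -scalerDr [v - u + _]addrC addrA subrK.
apply: nV.1 => //.
have [ts ds] : 0 < t / (t + d) /\ 0 < d / (t + d) by rewrite (divr_gt0 t0 s0) (divr_gt0 d0 s0).
by rewrite !normc_real (gtr0_norm ts) (gtr0_norm ds) -mulrDl mulfV ?gt_eqF.
Qed.

End denjoy_carleman.

Section lebesgue_measure_Rn.
Variable R : realType.

Local Notation RM := (measurableTypeR R).

Definition tuple_cons n (p : RM * n.-tuple RM) : n.+1.-tuple RM :=
  [the n.+1.-tuple RM of p.1 :: p.2].

Lemma measurable_tuple_cons n : measurable_fun setT (@tuple_cons n).
Proof. exact: measurable_cons. Qed.


Section step.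
Variables (n : nat) (mu : {sigma_finite_measure set (n.-tuple RM) -> \bar R}).

Definition lebesgue_cons : set (n.+1.-tuple RM) -> \bar R :=
  pushforward (lebesgue_measure \x mu)%E (@tuple_cons n).

Let measurable_tuple_cons_pre (A : set (n.+1.-tuple RM)) :
  measurable A -> measurable (@tuple_cons n @^-1` A).
Proof. by move=> mA; rewrite -[X in measurable X]setTI; exact: measurable_tuple_cons. Qed.

Let lebesgue_cons0 : lebesgue_cons set0 = 0%E.
Proof. by rewrite /lebesgue_cons /pushforward preimage_set0 measure0. Qed.

Let lebesgue_cons_ge0 A : (0 <= lebesgue_cons A)%E.
Proof. by rewrite /lebesgue_cons /pushforward measure_ge0. Qed.

Let lebesgue_cons_sigma_additive : semi_sigma_additive lebesgue_cons.
Proof.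
move=> F mF tF mUF; rewrite /lebesgue_cons /pushforward preimage_bigcup.
apply: measure_semi_sigma_additive.
- by move=> k; exact: measurable_tuple_cons_pre.
- apply/trivIsetP => i j _ _ ij; rewrite -preimage_setI.
  by move/trivIsetP : tF => /(_ _ _ _ _ ij) ->//; rewrite preimage_set0.
- by rewrite -preimage_bigcup; exact: measurable_tuple_cons_pre.
Qed.

HB.instance Definition _ := isMeasure.Build _ _ _ lebesgue_cons
  lebesgue_cons0 lebesgue_cons_ge0 lebesgue_cons_sigma_additive.

Let lebesgue_cons_sigma_finite : sigma_finite setT lebesgue_cons.
Proof.
have /sigma_finiteP[F [FT ndF Ffin]] := sigma_finiteT (@lebesgue_measure R).
have /sigma_finiteP[G [GT ndG Gfin]] := sigma_finiteT mu.
pose uncons (t : n.+1.-tuple RM) : RM * n.-tuple RM :=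
  (thead t, [tuple of behead t]).
have munc : measurable_fun setT uncons.
  apply/measurable_fun_pair; first exact: measurable_tnth.
  exact: measurable_behead.
have consK : cancel (@tuple_cons n) uncons.
  by case=> x t; congr (_, _); apply: val_inj.
exists (fun k => uncons @^-1` (F k `*` G k)).
  apply/esym; rewrite -subTset => t _.
  have [i _ Fi] : (\bigcup_i F i) (uncons t).1 by rewrite -FT.
  have [j _ Gj] : (\bigcup_i G i) (uncons t).2 by rewrite -GT.
  exists (maxn i j) => //; split.
    by move: Fi; exact/subsetPset/ndF/leq_maxl.
  by move: Gj; exact/subsetPset/ndG/leq_maxr.
move=> k; have [mFk Fk] := Ffin k; have [mGk Gk] := Gfin k; split.
  by rewrite -[X in measurable X]setTI; apply: munc => //; exact: measurableX.
rewrite /lebesgue_cons /pushforward -comp_preimage.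
rewrite (_ : _ \o _ = id) ?preimage_id; last exact/funext.
by rewrite product_measure1E// lte_mul_pinfty// ge0_fin_numE.
Qed.

HB.instance Definition _ := Measure_isSigmaFinite.Build _ _ _ lebesgue_cons
  lebesgue_cons_sigma_finite.

End step.

(* N-dimensional Lebesgue measure, as an iterated product measure. *)
Fixpoint lebesgueN n : {sigma_finite_measure set (n.-tuple RM) -> \bar R} :=
  match n with
  | 0 => \d_([tuple] : 0.-tuple RM)
  | n'.+1 => lebesgue_cons (lebesgueN n')
  end.

End lebesgue_measure_Rn.

Section fourier.
Variables (R : realType) (N : nat).
Implicit Types (xi : 'rV[int]_N) (x : 'rV[R]_N) (f : 'rV[R]_N -> R[i]).

Definition eucl xi : R := Num.sqrt (\sum_(j < N) (xi 0 j)%:~R ^+ 2).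

Definition dotp x xi : R := \sum_(j < N) x 0 j * (xi 0 j)%:~R.

(* e^{it} *)
Definition expi (t : R) : R[i] := cos t +i* sin t.

(* A fundamental domain of the torus; points are tuples because these carry    *)
(* the product sigma-algebra.                                                  *)
Definition torus_box : set (N.-tuple (measurableTypeR R)) :=
  [set t | forall j, 0 <= tnth t j <= 2 * pi].

Definition tuple_row (t : N.-tuple (measurableTypeR R)) : 'rV[R]_N :=
  \row_j (tnth t j : R).

Definition torus_integral f : R[i] :=
  (\int[lebesgueN R N]_(t in torus_box) re_part f (tuple_row t)) +i*
  (\int[lebesgueN R N]_(t in torus_box) im_part f (tuple_row t)).

Definition fourier_coef f xi : R[i] :=
  ((2 * pi) ^+ N)^-1%:C * torus_integral (fun x => expi (- dotp x xi) * f x).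

Definition fourier_partial (b : 'rV[int]_N -> R[i]) (j : nat) x : R[i] :=
  \sum_(xi \in [set xi | eucl xi <= j%:R]) b xi * expi (dotp x xi).

(* Convergence of the partial sums in the topological space [DC N M]; the      *)
(* partial sums [S j] are determined by their values.                          *)
Definition fourier_cvg_DC (M : weight_sequence R) (b : 'rV[int]_N -> R[i])
    (psi : DC N M) : Prop :=
  exists S : nat -> DC N M,
    (forall j x, S j x = fourier_partial b j x) /\ S @ \oo --> psi.

End fourier.

(* Main.v *)
Require Import Defs.
From mathcomp Require Import all_boot all_order all_algebra.
From mathcomp Require Import complex ring lra zify.
From mathcomp Require Import all_classical all_reals all_analysis.
From mathcomp Require Import measurable_realfun.
Import Order.TTheory GRing.Theory Num.Theory.
Import numFieldNormedType.Exports.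
Import ComplexField.Normc.
Set Implicit Arguments.
Unset Strict Implicit.
Unset Printing Implicit Defensive.
Local Open Scope classical_set_scope.
Local Open Scope ring_scope.
Local Open Scope complex_scope.

(** The hypothesis bounds |b_xi| (1 + |xi|)^n by C m_n n! / delta^n for every n.
    Taking n = k + q and splitting m_(k+q) and (k+q)! with the stability of the
    weights and of the factorials turns it into
      |b_xi| (1 + |xi|)^(k+q) <= A h^k m_k k!    for all k,
    with h = 2 H / delta ([weight_decay_of_inf]).  Here k is the order of a
    derivative and the q extra powers pay for summation: 2N of them make the
    series over Z^N absolutely convergent, because (1 + |xi|)^(-2N) is at most
    the product of the (1 + |xi_j|)^(-2), whose sum over any cube is at most 3^N
    ([sum_cube_le]); one more power makes the partial sums over |xi| <= j converge
    at the rate 1 / (1 + j), and a last one is traded for a factor 1 / (1 + j) in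
    the coefficients of the remainder.

    Everything about the sum F_c(x) of c_xi e^(i x xi) is read off bounds on the
    coefficients c, through [normc_fourier_sum_le].  A translation of x multiplies
    the coefficients by e^(i v xi), so that F_c(x + v) - F_c(x) and the first
    order Taylor remainder of F_c are again sums of such series; the elementary
    inequalities for e^(is) - 1 and e^(is) - 1 - is then bound these sums, which
    gives the continuity and the partial derivatives of F_c
    ([partial_fourier_sum]).  Iterating, D^alpha F_c has coefficients
    xi^alpha c_xi ([Dmulti_fourier_sum]), and the displayed bound says that
    psi = F_b lies in the class.  The partial sum S_j is the series whose
    coefficients are b cut off at |xi| <= j, so that S_j - psi is a series of the
    same kind with A replaced by A / (1 + j): it tends to 0 in the single space
    E_h, hence in the inductive limit ([fourier_cvg_DC_sum]).

    For the Fourier coefficients, S_j tends to psi uniformly, so it is enough to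
    integrate trigonometric polynomials over the box [0, 2 pi]^N; the integrals
    of the characters come from the one-dimensional ones by Fubini
    ([Rintegral_character], [fourier_coef_fourier_sum]). *)

(** * Real and imaginary parts, modulus, and the exponential e^{it} *)

Section complex_modulus.
Variable R : realType.
Implicit Types (z w : R[i]) (t : R).

Lemma ReD z w : complex.Re (z + w) = complex.Re z + complex.Re w.
Proof. by case: z w => [? ?] []. Qed.

Lemma ImD z w : complex.Im (z + w) = complex.Im z + complex.Im w.
Proof. by case: z w => [? ?] []. Qed.

Lemma ReB z w : complex.Re (z - w) = complex.Re z - complex.Re w.
Proof. by case: z w => [? ?] []. Qed.

Lemma ImB z w : complex.Im (z - w) = complex.Im z - complex.Im w.
Proof. by case: z w => [? ?] []. Qed.

Lemma normr_Re_le z : `|complex.Re z| <= normc z.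
Proof.
case: z => a b /=; rewrite -sqrtr_sqr ler_sqrt ?addr_ge0 ?sqr_ge0//.
by rewrite lerDl sqr_ge0.
Qed.

Lemma normr_Im_le z : `|complex.Im z| <= normc z.
Proof.
case: z => a b /=; rewrite -sqrtr_sqr ler_sqrt ?addr_ge0 ?sqr_ge0//.
by rewrite lerDr sqr_ge0.
Qed.

Lemma normc_le_ReIm z : normc z <= `|complex.Re z| + `|complex.Im z|.
Proof.
have -> : z = (complex.Re z)%:C + (0 +i* complex.Im z).
  by case: z => a b; congr (_ +i* _); rewrite /= ?addr0 ?add0r.
apply: le_trans (normcD _ _) _.
rewrite ReD ImD /= expr0n /= !addr0 !add0r !sqrtr_sqr //.
Qed.

Lemma normc_sum (I : Type) (r : seq I) (P : pred I) (F : I -> R[i]) :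
  normc (\sum_(i <- r | P i) F i) <= \sum_(i <- r | P i) normc (F i).
Proof.
elim/big_ind2 : _ => [|z x w y zx wy|//]; first by rewrite normc0.
by apply: le_trans (normcD _ _) _; exact: lerD.
Qed.

Lemma normcX z n : normc (z ^+ n) = normc z ^+ n.
Proof. by elim: n => [|n IH]; rewrite ?expr0 ?normc1// !exprS normcM IH. Qed.

Lemma normc_expi t : normc (expi t) = 1.
Proof. by rewrite /= cos2Dsin2 sqrtr1. Qed.

Lemma expiD (s t : R) : expi (s + t) = expi s * expi t.
Proof.
rewrite /expi cosD sinD; apply/eqP; rewrite eq_complex /=.
by rewrite eqxx /= addrC.
Qed.

Lemma expi0 : expi (0 : R) = 1.
Proof. by rewrite /expi cos0 sin0. Qed.

End complex_modulus.

(** * Summability over the lattice *)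

Section lattice_sums.
Variables (R : realType) (N : nat).
Implicit Types xi : 'rV[int]_N.

Definition jbracket xi : R := 1 + eucl R xi.

Lemma eucl_ge0 xi : 0 <= eucl R xi.
Proof. exact: sqrtr_ge0. Qed.

Lemma jbracket_ge1 xi : 1 <= jbracket xi.
Proof. by rewrite lerDl eucl_ge0. Qed.

Lemma jbracket_gt0 xi : 0 < jbracket xi.
Proof. exact: lt_le_trans ltr01 (jbracket_ge1 xi). Qed.

Lemma normr_coord_le_eucl xi j : `|(xi 0 j)%:~R| <= eucl R xi.
Proof.
rewrite /eucl -sqrtr_sqr ler_sqrt; last by apply: sumr_ge0 => *; rewrite sqr_ge0.
rewrite (bigD1 j)//= lerDl; apply: sumr_ge0 => *; exact: sqr_ge0.
Qed.

(** The points of Z^N with all coordinates in [-k, k].  The summation over the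
    cube is a [bigop] over a finite type of functions, to which the distributivity
    of products over sums applies. *)
Definition cube (k : nat) : finType := {ffun 'I_N -> 'I_k.*2.+1}.

Definition cube_pt k (f : cube k) : 'rV[int]_N :=
  \row_j ((f j : nat)%:Z - k%:Z).

Lemma cube_pt_inj k : injective (@cube_pt k).
Proof.
move=> f g /rowP fg; apply/ffunP => j; have := fg j; rewrite !mxE.
by move/addIr => [] /val_inj.
Qed.

Lemma ball_cube k xi : eucl R xi <= k%:R -> exists f : cube k, cube_pt f = xi.
Proof.
move=> xik.
have bnd j : (`|xi 0%R j| <= k)%N.
  rewrite -(ler_nat R); apply: le_trans xik.
  by have := normr_coord_le_eucl xi j; rewrite -intr_norm -abszE -pmulrn.
(* coordinates are shifted by k, so as to be indices in [0, 2k] *)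
exists [ffun j => inord `|(xi 0 j + k%:Z)%R|%N].
apply/rowP => j; rewrite !mxE ffunE inordK.
  by have := bnd j; lia.
by have := bnd j; lia.
Qed.

(** All the partial sums up to radius k are sums over one finite type, the cube
    of radius k; two of them can then be subtracted by splitting a predicate. *)
Lemma sum_ball_cube (V : nmodType) (g : 'rV[int]_N -> V) j k : (j <= k)%N ->
  \sum_(xi \in [set xi | eucl R xi <= j%:R]) g xi =
  \sum_(f : cube k | eucl R (cube_pt f) <= j%:R) g (cube_pt f).
Proof.
move=> jk.
have bigE := @bigfs V 0 +%R (cube k) (index_enum (cube k))
  (fun f => eucl R (cube_pt f) <= j%:R) (fun f => g (cube_pt f)) (index_enum_uniq _).
rewrite bigE; last by move=> f _; rewrite mem_index_enum.
apply: reindex_fsbig; split.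
- by move=> f /= fj.
- by move=> f g' _ _; exact: cube_pt_inj.
- move=> xi /= xij.
  have [f fE] : exists f : cube k, cube_pt f = xi.
    by apply: ball_cube; apply: le_trans xij _; rewrite ler_nat.
  by exists f => //=; rewrite unfold_in fE.
Qed.

(** The gain 2 / (k+2)^2 of the two new points is at most the telescoping
    difference 2 / (k+1) - 2 / (k+2). *)
Lemma sum_inv_sqr_le k :
  \sum_(i < k.*2.+1) ((1 + `|((i : nat)%:Z - k%:Z)%:~R|) ^+ 2)^-1 <= 3 - 2 / k.+1%:R :> R.
Proof.
elim: k => [|k IH].
  by rewrite big_ord1 subrr normr0 addr0 expr1n !invr1; lra.
rewrite doubleS big_ord_recl big_ord_recr /=.
have -> : `|(0%:Z - k.+1%:Z)%:~R| = k.+1%:R :> R.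
  by rewrite sub0r rmorphN normrN /= -pmulrn normr_nat.
have -> : `|((bump 0 k.*2.+1)%:Z - k.+1%:Z)%:~R| = k.+1%:R :> R.
  have -> : (bump 0 k.*2.+1)%:Z - k.+1%:Z = k.+1%:Z by rewrite /bump /=; lia.
  by rewrite -pmulrn normr_nat.
under eq_bigr => i _.
  have -> : (lift ord0 (widen_ord (leqnSn k.*2.+1) i) : nat)%:Z - k.+1%:Z =
      (i : nat)%:Z - k%:Z.
    by rewrite /= /bump /=; lia.
  over.
rewrite addrCA; apply: le_trans (lerD IH (lexx _)) _.
rewrite -(natrD _ 1 k.+1) add1n -[k.+2%:R]natr1.
set a : R := k.+1%:R.
have a0 : 0 < a by rewrite ltr0n.
clearbody a.
have an0 : a != 0 by rewrite gt_eqF.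
have a1n0 : a + 1 != 0 by rewrite gt_eqF ?addr_gt0.
rewrite -subr_ge0.
have -> : 3 - 2 / (a + 1) - (3 - 2 / a + (((a + 1) ^+ 2)^-1 + ((a + 1) ^+ 2)^-1)) =
  2 / (a * (a + 1) ^+ 2) . by field; rewrite a1n0 an0.
by apply: divr_ge0 => //; apply: mulr_ge0; [exact: ltW|exact: sqr_ge0].
Qed.

(** The bound does not depend on k, which is what absolute convergence needs.
    It holds because a sum over the cube of a product of functions of the single
    coordinates is the product of N one-dimensional sums. *)
Lemma sum_cube_le k (P : pred (cube k)) (g : 'rV[int]_N -> R) (A : R) : 0 <= A ->
  (forall xi, 0 <= g xi) ->
  (forall f, P f -> g (cube_pt f) * jbracket (cube_pt f) ^+ N.*2 <= A) ->
  \sum_(f | P f) g (cube_pt f) <= A * 3 ^+ N.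
Proof.
move=> A0 g0 gA.
(* w is a summable product of functions of the coordinates, dominating the
   power of the bracket since each |xi_j| is at most |xi| *)
pose w xi : R := \prod_(j < N) ((1 + `|(xi 0 j)%:~R|) ^+ 2)^-1.
have p0 xi j : 0 < (1 + `|(xi 0 j)%:~R : R|) ^+ 2.
  by rewrite exprn_gt0// ltr_pwDl.
have w0 xi : 0 < w xi by apply: prodr_gt0 => j _; rewrite invr_gt0.
have wle xi : (jbracket xi ^+ N.*2)^-1 <= w xi.
  have -> : jbracket xi ^+ N.*2 = \prod_(j < N) jbracket xi ^+ 2.
    by rewrite prodr_const card_ord -exprM mul2n.
  rewrite -prodfV; apply: ler_prod => j _.
  rewrite invr_ge0 exprn_ge0 ?(ltW (jbracket_gt0 _))//=.
  rewrite lef_pV2 ?posrE ?exprn_gt0 ?jbracket_gt0 ?ltr_pwDl//.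
  by rewrite lerXn2r ?nnegrE ?addr_ge0 ?eucl_ge0// lerD2l normr_coord_le_eucl.
have gw f : P f -> g (cube_pt f) <= A * w (cube_pt f).
  move=> /gA; rewrite -ler_pdivlMr ?exprn_gt0 ?jbracket_gt0// => /le_trans; apply.
  by rewrite ler_wpM2l.
apply: le_trans (ler_sum _ gw) _; rewrite -mulr_sumr ler_wpM2l//.
apply: (@le_trans _ _ (\sum_(f : cube k) w (cube_pt f))).
  rewrite [leRHS](bigID P)/= lerDl; apply: sumr_ge0 => f _; exact: ltW.
rewrite /w /cube_pt.
under eq_bigr => f _ do under eq_bigr => j _ do rewrite mxE.
rewrite -(@bigA_distr_bigA _ _ _ _ _ 'I_N 'I_k.*2.+1
  (fun j i => ((1 + `|((i : nat)%:Z - k%:Z)%:~R|) ^+ 2)^-1)) /=.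
have -> : 3 ^+ N = \prod_(j < N) (3 : R) by rewrite prodr_const card_ord.
apply: ler_prod => j _; apply/andP; split.
  by apply: sumr_ge0 => i _; rewrite invr_ge0 sqr_ge0.
apply: le_trans (sum_inv_sqr_le k) _.
by rewrite lerBlDr lerDl divr_ge0.
Qed.

End lattice_sums.

(** * Sequences with tails of order 1/j *)

Section harmonic_tail.
Variable R : realType.
Implicit Types (u : nat -> R) (K : R).

Lemma cvg_div_succ K : (K / j.+1%:R) @[j --> \oo] --> 0.
Proof.
by rewrite -[0](mulr0 K); apply: cvgMr; exact: (@cvg_harmonic R).
Qed.

Lemma cvg_of_harmonic_tail u K :
  (forall j k, (j <= k)%N -> `|u k - u j| <= K / j.+1%:R) -> cvgn u.
Proof.
move=> uK; apply/cauchy_cvgP/cauchy_exP => e e0.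
have /cvgrPdist_lt/(_ e e0)[n _ nP] := cvg_div_succ K.
exists (u n); exists n => // k /= nk; rewrite /ball /= distrC.
apply: le_lt_trans (uK n k nk) _.
by have := nP n (leqnn n); rewrite sub0r normrN; exact/le_lt_trans/ler_norm.
Qed.

(** Letting k tend to infinity keeps the tail bound, so the same K measures
    the distance from each term to the limit. *)
Lemma lim_harmonic_tail u K l j : u @ \oo --> l ->
  (forall k, (j <= k)%N -> `|u k - u j| <= K / j.+1%:R) -> `|l - u j| <= K / j.+1%:R.
Proof.
move=> ul uK.
have dl : `|u k - u j| @[k --> \oo] --> `|l - u j|.
  by apply: cvg_norm; apply: cvgB => //; exact: cvg_cst.
rewrite -(cvg_lim (@Rhausdorff R) dl); apply: limr_le; first exact: cvgP dl.
by exists j => // k /= /uK.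
Qed.

Lemma harmonic_bound_eq (s : R) K n :
  (forall j, (n <= j)%N -> `|s| <= K / j.+1%:R) -> s = 0.
Proof.
move=> sK; apply/eqP; rewrite -normr_le0; rewrite leNgt; apply/negP => s0.
have /cvgrPdist_lt/(_ _ s0)[m _ mP] := cvg_div_succ K.
have := mP (maxn m n) (leq_maxl m n); rewrite sub0r normrN.
move/(le_lt_trans (ler_norm _)); apply/negP; rewrite -leNgt.
by apply: sK; exact: leq_maxr.
Qed.

Lemma complex_eq_of_harmonic_bound (z w : R[i]) K n :
  (forall j, (n <= j)%N ->
    `|complex.Re z - complex.Re w| <= K / j.+1%:R /\
    `|complex.Im z - complex.Im w| <= K / j.+1%:R) -> z = w.
Proof.
move=> zw; apply/eqP; rewrite eq_complex -[X in X && _]subr_eq0 -[X in _ && X]subr_eq0.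
by apply/andP; split; apply/eqP; apply: (@harmonic_bound_eq _ K n) => j /zw[].
Qed.

End harmonic_tail.

(** * Trigonometric series with decaying coefficients *)

Section trigonometric_series.
Variables (R : realType) (N : nat).
Implicit Types (c d : 'rV[int]_N -> R[i]) (A : R) (x v : 'rV[R]_N) (j k : nat).

(** The order k = 2N gives summability, and k = 2N + 1 a rate of convergence. *)
Definition coef_bound k A c : Prop :=
  forall xi, normc (c xi) * jbracket R xi ^+ k <= A.

Lemma coef_bound_ge0 k A c : coef_bound k A c -> 0 <= A.
Proof.
move=> /(_ 0); apply: le_trans; rewrite mulr_ge0 ?normc_ge0//.
by rewrite exprn_ge0// ltW// jbracket_gt0.
Qed.

Lemma coef_boundW k k' A c : (k <= k')%N -> coef_bound k' A c -> coef_bound k A c.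
Proof.
move=> kk' cA xi; apply: le_trans (cA xi).
by rewrite ler_wpM2l ?normc_ge0// ler_weXn2l ?jbracket_ge1.
Qed.

Lemma partial_cube c j k x : (j <= k)%N -> fourier_partial c j x =
  \sum_(f : cube N k | eucl R (cube_pt f) <= j%:R)
    c (cube_pt f) * expi (dotp x (cube_pt f)).
Proof. exact: (sum_ball_cube R (fun xi => c xi * expi (dotp x xi))). Qed.

Lemma normc_partial_le c A j x : coef_bound N.*2 A c ->
  normc (fourier_partial c j x) <= A * 3 ^+ N.
Proof.
move=> cA; rewrite (partial_cube _ _ (leqnn j)); apply: le_trans (normc_sum _ _ _) _.
under eq_bigr do rewrite normcM normc_expi mulr1.
apply: (sum_cube_le (g := fun xi => normc (c xi))).
- exact: coef_bound_ge0 cA.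
- by move=> xi; exact: normc_ge0.
- by move=> f _; exact: cA.
Qed.

(** In the shells j < |xi| <= k the last power of 1 + |xi| exceeds 1 + j; the
    other 2N powers are used for summation. *)
Lemma normc_partialB_le c A j k x : coef_bound N.*2.+1 A c -> (j <= k)%N ->
  normc (fourier_partial c k x - fourier_partial c j x) <= A * 3 ^+ N / j.+1%:R.
Proof.
move=> cA jk; rewrite (partial_cube _ _ jk) (partial_cube _ _ (leqnn k)).
rewrite (bigID (fun f : cube N k => eucl R (cube_pt f) <= j%:R)) /=.
set s1 := (X in X + _ - _); set s2 := (X in _ + X - _); set s3 := (X in _ - X).
have -> : s1 = s3.
  apply: eq_bigl => f; rewrite andbC; case: (leP _ j%:R) => //= fj.
  by rewrite (le_trans fj)// ler_nat.
rewrite addrAC subrr add0r /s2; apply: le_trans (normc_sum _ _ _) _.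
under eq_bigr do rewrite normcM normc_expi mulr1.
rewrite mulrAC; apply: (sum_cube_le (g := fun xi => normc (c xi))).
- by apply: divr_ge0 => //; exact: coef_bound_ge0 cA.
- by move=> xi; exact: normc_ge0.
- move=> f /andP[_]; rewrite -ltNge => fj; rewrite ler_pdivlMr ?ltr0n//.
  apply: le_trans (cA (cube_pt f)); rewrite exprSr mulrA ler_wpM2l//.
    by rewrite mulr_ge0 ?normc_ge0 ?exprn_ge0// ltW// jbracket_gt0.
  by rewrite -natr1 addrC lerD2l ltW.
Qed.

(** The limit is taken on real and imaginary parts, as the completeness of the
    real line is all that its existence requires. *)
Definition fourier_sum c x : R[i] :=
  limn (fun j => complex.Re (fourier_partial c j x)) +i*
  limn (fun j => complex.Im (fourier_partial c j x)).

Definition cvgC (u : nat -> R[i]) (z : R[i]) : Prop :=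
  (fun j => complex.Re (u j)) @ \oo --> complex.Re z /\
  (fun j => complex.Im (u j)) @ \oo --> complex.Im z.

Lemma cvgC_unique u z w : cvgC u z -> cvgC u w -> z = w.
Proof.
move=> [r i] [r' i']; apply/eqP; rewrite eq_complex.
by rewrite (cvg_unique _ r r')// (cvg_unique _ i i')// !eqxx.
Qed.

Lemma cvgCD (u v : nat -> R[i]) z w :
  cvgC u z -> cvgC v w -> cvgC (fun j => u j + v j) (z + w).
Proof.
move=> [r i] [r' i']; split.
  by rewrite ReD; under eq_fun do rewrite ReD; exact: cvgD.
by rewrite ImD; under eq_fun do rewrite ImD; exact: cvgD.
Qed.

Lemma cvgCZ a u z : cvgC u z -> cvgC (fun j => a * u j) (a * z).
Proof.
case: a => a b [r i].
have ReM w : complex.Re ((a +i* b) * w) = a * complex.Re w - b * complex.Im w by case: w.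
have ImM w : complex.Im ((a +i* b) * w) = a * complex.Im w + b * complex.Re w by case: w.
split.
  by rewrite ReM; under eq_fun do rewrite ReM; apply: cvgB; exact: cvgMr.
by rewrite ImM; under eq_fun do rewrite ImM; apply: cvgD; exact: cvgMr.
Qed.

Lemma cvgCB (u v : nat -> R[i]) z w :
  cvgC u z -> cvgC v w -> cvgC (fun j => u j - v j) (z - w).
Proof.
move=> uz vw; have := cvgCD uz (cvgCZ (-1) vw).
by rewrite mulN1r; under eq_fun do rewrite mulN1r.
Qed.

Lemma fourier_sumP c A x : coef_bound N.*2.+1 A c ->
  cvgC (fourier_partial c ^~ x) (fourier_sum c x).
Proof.
move=> cA; split; apply: (@cvg_of_harmonic_tail _ _ (A * 3 ^+ N)) => j k jk.
  rewrite -ReB; apply: le_trans (normr_Re_le _) _; exact: normc_partialB_le.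
rewrite -ImB; apply: le_trans (normr_Im_le _) _; exact: normc_partialB_le.
Qed.

Lemma Re_fourier_sumB c A x j : coef_bound N.*2.+1 A c ->
  `|complex.Re (fourier_sum c x) - complex.Re (fourier_partial c j x)| <=
  A * 3 ^+ N / j.+1%:R.
Proof.
move=> cA; have [r _] := fourier_sumP x cA.
apply: (lim_harmonic_tail r) => k jk /=; rewrite -ReB.
by apply: le_trans (normr_Re_le _) _; exact: normc_partialB_le.
Qed.

Lemma Im_fourier_sumB c A x j : coef_bound N.*2.+1 A c ->
  `|complex.Im (fourier_sum c x) - complex.Im (fourier_partial c j x)| <=
  A * 3 ^+ N / j.+1%:R.
Proof.
move=> cA; have [_ i] := fourier_sumP x cA.
apply: (lim_harmonic_tail i) => k jk /=; rewrite -ImB.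
by apply: le_trans (normr_Im_le _) _; exact: normc_partialB_le.
Qed.

Lemma normc_fourier_sum_le c A x : coef_bound N.*2.+1 A c ->
  normc (fourier_sum c x) <= 2 * A * 3 ^+ N.
Proof.
move=> cA; have [r i] := fourier_sumP x cA.
have cA' := coef_boundW (leqnSn _) cA.
apply: le_trans (normc_le_ReIm _) _; rewrite -mulrA mulr2n mulrDl mul1r; apply: lerD.
  rewrite -(cvg_lim (@Rhausdorff R) (cvg_norm r)); apply: limr_le.
    exact: cvgP (cvg_norm r).
  apply: nearW => j; apply: le_trans (normr_Re_le _) _; exact: normc_partial_le.
rewrite -(cvg_lim (@Rhausdorff R) (cvg_norm i)); apply: limr_le.
  exact: cvgP (cvg_norm i).
apply: nearW => j; apply: le_trans (normr_Im_le _) _; exact: normc_partial_le.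
Qed.

Lemma fourier_partialB c d j x :
  fourier_partial (c \- d) j x = fourier_partial c j x - fourier_partial d j x.
Proof.
rewrite !(partial_cube _ _ (leqnn j)) -sumrB; apply: eq_bigr => f _.
by rewrite mulrBl.
Qed.

Lemma fourier_partialZ a c j x :
  fourier_partial (fun xi => a * c xi) j x = a * fourier_partial c j x.
Proof.
rewrite !(partial_cube _ _ (leqnn j)) mulr_sumr; apply: eq_bigr => f _.
by rewrite mulrA.
Qed.

(** Translating the variable is the same as rotating each coefficient; every
    regularity statement below rests on this. *)
Lemma fourier_partial_shift c j x v :
  fourier_partial c j (x + v) = fourier_partial (fun xi => c xi * expi (dotp v xi)) j x.
Proof.
rewrite !(partial_cube _ _ (leqnn j)); apply: eq_bigr => f _.
rewrite -mulrA -expiD; congr (_ * expi _).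
rewrite /dotp -big_split /=; apply: eq_bigr => i _.
by rewrite mxE mulrDl addrC.
Qed.

Lemma coef_boundB k A B c d : coef_bound k A c -> coef_bound k B d ->
  coef_bound k (A + B) (c \- d).
Proof.
move=> cA dB xi; apply: le_trans (lerD (cA xi) (dB xi)); rewrite -mulrDl ler_wpM2r//.
  by rewrite exprn_ge0// ltW// jbracket_gt0.
by apply: le_trans (normcD _ _) _; rewrite normcN.
Qed.

Lemma coef_boundZ k A a c : coef_bound k A c ->
  coef_bound k (normc a * A) (fun xi => a * c xi).
Proof.
by move=> cA xi; rewrite normcM -mulrA ler_wpM2l ?normc_ge0.
Qed.

Lemma coef_bound_expi k A v c : coef_bound k A c ->
  coef_bound k A (fun xi => c xi * expi (dotp v xi)).
Proof. by move=> cA xi; rewrite normcM normc_expi mulr1. Qed.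

Lemma fourier_sumB c d A B x : coef_bound N.*2.+1 A c -> coef_bound N.*2.+1 B d ->
  fourier_sum (c \- d) x = fourier_sum c x - fourier_sum d x.
Proof.
move=> cA dB; apply: cvgC_unique (fourier_sumP x (coef_boundB cA dB)) _.
have -> : fourier_partial (c \- d) ^~ x =
    fun j => fourier_partial c j x - fourier_partial d j x.
  by apply/funext => j; exact: fourier_partialB.
exact: cvgCB (fourier_sumP x cA) (fourier_sumP x dB).
Qed.

Lemma fourier_sumZ a c A x : coef_bound N.*2.+1 A c ->
  fourier_sum (fun xi => a * c xi) x = a * fourier_sum c x.
Proof.
move=> cA; apply: cvgC_unique (fourier_sumP x (coef_boundZ a cA)) _.
have -> : fourier_partial (fun xi => a * c xi) ^~ x = fun j => a * fourier_partial c j x.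
  by apply/funext => j; exact: fourier_partialZ.
exact: cvgCZ (fourier_sumP x cA).
Qed.

Lemma fourier_sum_shift c x v :
  fourier_sum c (x + v) = fourier_sum (fun xi => c xi * expi (dotp v xi)) x.
Proof.
by rewrite /fourier_sum; under eq_fun do rewrite fourier_partial_shift;
   under [X in _ +i* limn X]eq_fun do rewrite fourier_partial_shift.
Qed.

(** Cutting the coefficients off makes a partial sum into a full series, so that
    the lemmas on [fourier_sum] also apply to partial sums and to remainders. *)
Definition truncate (j : nat) c (xi : 'rV[int]_N) : R[i] :=
  if eucl R xi <= j%:R then c xi else 0.

Lemma coef_bound_truncate k A j c : coef_bound k A c -> coef_bound k A (truncate j c).
Proof.
move=> cA xi; rewrite /truncate; case: ifP => // _.
by rewrite normc0 mul0r; exact: coef_bound_ge0 cA.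
Qed.

(** One power of decay is traded for the factor 1 / (1 + j), as only the
    frequencies |xi| > j are left. *)
Lemma coef_bound_tail k A j c : coef_bound k.+1 A c ->
  coef_bound k (A / j.+1%:R) (truncate j c \- c).
Proof.
move=> cA xi; rewrite /truncate /=; case: (leP (eucl R xi) j%:R) => [_|xij].
  by rewrite subrr normc0 mul0r divr_ge0// (coef_bound_ge0 cA).
rewrite sub0r normcN ler_pdivlMr ?ltr0n//.
apply: le_trans (cA xi); rewrite exprSr mulrA ler_wpM2l//.
  by rewrite mulr_ge0 ?normc_ge0 ?exprn_ge0// ltW// jbracket_gt0.
by rewrite -natr1 addrC lerD2l ltW.
Qed.

Lemma fourier_sum_truncate c A j x : coef_bound N.*2.+1 A c ->
  fourier_sum (truncate j c) x = fourier_partial c j x.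
Proof.
move=> cA; apply: cvgC_unique (fourier_sumP x (coef_bound_truncate j cA)) _.
have E k : (j <= k)%N -> fourier_partial (truncate j c) k x = fourier_partial c j x.
  move=> jk; rewrite (partial_cube _ _ jk) (partial_cube _ _ (leqnn k)).
  rewrite [RHS]big_mkcond [LHS]big_mkcond; apply: eq_bigr => f _.
  rewrite /truncate; case: (leP (eucl R (cube_pt f)) j%:R) => fj;
    last by rewrite mul0r if_same.
  by rewrite (le_trans fj)// ler_nat.
split.
  apply: cvg_near_cst; exists j => // k /= jk; by rewrite E.
by apply: cvg_near_cst; exists j => // k /= jk; rewrite E.
Qed.

End trigonometric_series.

(** * Taylor estimates for e^{it} and derivatives from quadratic bounds *)

Section calculus.
Variable R : realType.
Implicit Types (t : R).

Lemma mvt_from0 (f df : R -> R) t : (forall x : R, is_derive x 1 f (df x)) ->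
  exists2 s, `|s| <= `|t| & f t - f 0 = df s * t.
Proof.
move=> fdf.
have cf (a b : R) : {within `[a, b], continuous f}.
  apply: derivable_within_continuous => x _; exact: ex_derive.
case: (leP 0 t) => t0.
  have [s + E] := MVT_segment t0 (fun x _ => fdf x) (cf 0 t).
  rewrite in_itv /= => /andP[s0 st]; exists s; first by rewrite !ger0_norm.
  by rewrite E subr0.
have [s + E] := MVT_segment (ltW t0) (fun x _ => fdf x) (cf t 0).
rewrite in_itv /= => /andP[st s0]; exists s.
  by rewrite !ler0_norm ?lerN2// ltW.
by rewrite -opprB E sub0r mulrN opprK.
Qed.

Lemma normr_sin_le t : `|sin t| <= `|t|.
Proof.
have [s _] := mvt_from0 t (fun x => is_derive_sin x).
rewrite sin0 subr0 => ->; rewrite normrM ler_piMl//; exact: cos_max.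
Qed.

Lemma normr_cosB1_le t : `|cos t - 1| <= `|t|.
Proof.
have [s _] := mvt_from0 t (fun x => is_derive_cos x).
rewrite cos0 => ->; rewrite normrM normrN ler_piMl//; exact: sin_max.
Qed.

Lemma normr_cosB1_le_sqr t : `|cos t - 1| <= t ^+ 2.
Proof.
have [s st] := mvt_from0 t (fun x => is_derive_cos x).
rewrite cos0 => ->; rewrite normrM normrN -real_normK ?num_real// expr2 ler_wpM2r//.
exact: le_trans (normr_sin_le s) st.
Qed.

Lemma normr_sinB_le_sqr t : `|sin t - t| <= t ^+ 2.
Proof.
have [s st] := mvt_from0 t (fun x => is_derive_sin x).
rewrite sin0 subr0 => ->; rewrite -[X in _ * t - X]mul1r -mulrBl normrM.
rewrite -real_normK ?num_real// expr2 ler_wpM2r//.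
exact: le_trans (normr_cosB1_le s) st.
Qed.

Lemma normc_expiB1_le t : normc (expi t - 1) <= 2 * `|t|.
Proof.
apply: le_trans (normc_le_ReIm _) _; rewrite mulr2n mulrDl mul1r /= subr0.
by apply: lerD; [exact: normr_cosB1_le|exact: normr_sin_le].
Qed.

Lemma normc_expi_taylor1_le t : normc (expi t - 1 - (0 +i* t)) <= 2 * t ^+ 2.
Proof.
apply: le_trans (normc_le_ReIm _) _; rewrite mulr2n mulrDl mul1r /= !subr0.
by apply: lerD; [exact: normr_cosB1_le_sqr|exact: normr_sinB_le_sqr].
Qed.

(** A quadratic bound on the Taylor remainder along a line identifies the
    directional derivative; it is how series are differentiated here. *)
Lemma is_derive_quadratic (V : normedModType R) (g : V -> R) (x v : V) (l K : R) :
  (forall t, `|g (x + t *: v) - g x - t * l| <= K * t ^+ 2) -> is_derive x v g l.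
Proof.
move=> gK.
have K0 : 0 <= K by have := gK 1; rewrite expr1n mulr1; exact: le_trans.
suff cl : h^-1 *: ((g \o shift x) (h *: v) - g x) @[h --> 0^'] --> l.
  split; first exact: cvgP cl.
  exact: (cvg_lim (@Rhausdorff R) cl).
apply/cvgrPdist_le => e e0.
have d0 : 0 < e / (K + 1) by rewrite divr_gt0// ltr_wpDl.
near=> h.
have hn0 : h != 0 by near: h; exact: nbhs_dnbhs_neq.
have hn : 0 < `|h| by rewrite normr_gt0.
rewrite /= [h *: v + x]addrC distrC -(ler_pM2l hn) -normrM.
rewrite mulrBr /GRing.scale/= mulrA mulfV// mul1r; apply: le_trans (gK h) _.
have hd : `|h| <= e / (K + 1) by near: h; exact: dnbhs0_le.
rewrite -real_normK ?num_real// expr2 mulrCA ler_wpM2l//.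
apply: (@le_trans _ _ ((K + 1) * `|h|)).
  by rewrite ler_wpM2r// lerDl.
by rewrite mulrC -ler_pdivlMr// ltr_wpDl.
Unshelve. all: by end_near. Qed.

Lemma continuous_lipschitz (V : normedModType R) (g : V -> R) (K : R) :
  (forall x v, `|g (x + v) - g x| <= K * `|v|) -> continuous g.
Proof.
move=> gK x; apply/cvgrPdist_le => e e0.
have d0 : 0 < e / (`|K| + 1) by rewrite divr_gt0// ltr_wpDl.
near=> y.
have yd : `|x - y| <= e / (`|K| + 1).
  by near: y; apply: cvgr_dist_le => //; exact: cvg_id.
have := gK x (y - x); rewrite subrKC distrC => /le_trans; apply.
rewrite distrC; apply: (@le_trans _ _ ((`|K| + 1) * `|x - y|)).
  by rewrite ler_wpM2r// (le_trans (ler_norm K))// lerDl.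
by rewrite mulrC -ler_pdivlMr// ltr_wpDl.
Unshelve. all: by end_near. Qed.

End calculus.

(** * Smoothness of trigonometric series *)

Section smoothness.
Variables (R : realType) (N : nat).
Implicit Types (c d : 'rV[int]_N -> R[i]) (A : R) (x v : 'rV[R]_N) (xi : 'rV[int]_N).

Definition rapid_decay c : Prop := forall k, exists A, coef_bound k A c.

Lemma normr_coord_le (x : 'rV[R]_N) j : `|x 0 j| <= `|x|.
Proof.
rewrite [leRHS]/Num.norm /= mx_normrE.
exact: (le_bigmax _ (fun ij : 'I_1 * 'I_N => `|x ij.1 ij.2|) (0, j)).
Qed.

Lemma normr_dotp_le v xi : `|dotp v xi| <= N%:R * `|v| * jbracket R xi.
Proof.
apply: le_trans (ler_norm_sum _ _ _) _.
have -> : N%:R * `|v| * jbracket R xi = \sum_(j < N) `|v| * jbracket R xi.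
  by rewrite sumr_const card_ord -mulrA mulr_natl.
apply: ler_sum => j _; rewrite normrM; apply: ler_pM => //.
  exact: normr_coord_le.
apply: le_trans (normr_coord_le_eucl R xi j) _.
by rewrite lerDr.
Qed.

Lemma dotp_delta (t : R) j xi : dotp (t *: delta_mx 0 j) xi = t * (xi 0 j)%:~R.
Proof.
rewrite /dotp (bigD1 j)//= big1 ?addr0; last first.
  by move=> i /negbTE ij; rewrite !mxE ij andbF mulr0 mul0r.
by rewrite !mxE !eqxx mulr1.
Qed.

(** From |e^(is) - 1| <= 2 |s| with s = v . xi; the factor |xi| in |s| costs one
    power of decay. *)
Lemma coef_bound_lipschitz k A c v : coef_bound k.+1 A c ->
  coef_bound k (2 * N%:R * A * `|v|) ((fun xi => c xi * expi (dotp v xi)) \- c).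
Proof.
move=> cA xi; rewrite /= -[X in _ - X]mulr1 -mulrBr normcM.
have jk0 : 0 <= jbracket R xi ^+ k by rewrite exprn_ge0// ltW// jbracket_gt0.
apply: (@le_trans _ _
  (normc (c xi) * (2 * (N%:R * `|v| * jbracket R xi)) * jbracket R xi ^+ k)).
  rewrite ler_wpM2r// ler_wpM2l ?normc_ge0//.
  by apply: le_trans (normc_expiB1_le _) _; rewrite ler_wpM2l// normr_dotp_le.
have -> : normc (c xi) * (2 * (N%:R * `|v| * jbracket R xi)) * jbracket R xi ^+ k =
  2 * N%:R * (normc (c xi) * jbracket R xi ^+ k.+1) * `|v| by rewrite exprS; ring.
by rewrite ler_wpM2r// ler_wpM2l.
Qed.

(** The coefficients of the partial derivative in the direction j. *)
Definition freq_mul j c xi : R[i] := (0 +i* (xi 0 j)%:~R) * c xi.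

Lemma normc_imag (s : R) : normc (0 +i* s) = `|s|.
Proof. by rewrite /= expr0n add0r sqrtr_sqr. Qed.

Lemma coef_bound_freq_mul k A j c : coef_bound k.+1 A c -> coef_bound k A (freq_mul j c).
Proof.
move=> cA xi; rewrite normcM normc_imag; apply: le_trans (cA xi).
rewrite exprS [X in X * _]mulrC -mulrA ler_wpM2l ?normc_ge0// ler_wpM2r//.
  by rewrite exprn_ge0// ltW// jbracket_gt0.
by apply: le_trans (normr_coord_le_eucl R xi j) _; rewrite lerDr.
Qed.

(** From |e^(is) - 1 - is| <= 2 s^2 with s = t xi_j, which costs two powers of
    decay. *)
Lemma coef_bound_taylor k A j c (t : R) : coef_bound k.+2 A c ->
  coef_bound k (2 * A * t ^+ 2)
    (((fun xi => c xi * expi (dotp (t *: delta_mx 0 j) xi)) \- c) \-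
     (fun xi => t%:C * freq_mul j c xi)).
Proof.
move=> cA xi; rewrite /= dotp_delta /freq_mul.
have -> : c xi * expi (t * (xi 0 j)%:~R) - c xi - t%:C * ((0 +i* (xi 0 j)%:~R) * c xi) =
  c xi * (expi (t * (xi 0 j)%:~R) - 1 - (0 +i* (t * (xi 0 j)%:~R))).
  have -> : (0 +i* (t * (xi 0 j)%:~R)) = t%:C * (0 +i* (xi 0 j)%:~R) :> R[i].
    by apply/eqP; rewrite eq_complex /= !mul0r mulr0 subr0 addr0 !eqxx.
  by rewrite !mulrBr mulr1 [in RHS]mulrCA [c xi * (0 +i* _)]mulrC.
rewrite normcM.
have j0 := jbracket_gt0 R xi.
apply: (@le_trans _ _
  (normc (c xi) * (2 * (t ^+ 2 * jbracket R xi ^+ 2)) * jbracket R xi ^+ k)).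
  rewrite ler_wpM2r ?exprn_ge0 ?(ltW j0)// ler_wpM2l ?normc_ge0//.
  apply: le_trans (normc_expi_taylor1_le _) _.
  rewrite ler_wpM2l// exprMn ler_wpM2l ?sqr_ge0//.
  rewrite -[leLHS]real_normK ?num_real// lerXn2r ?nnegrE ?(ltW j0)//.
  by apply: le_trans (normr_coord_le_eucl R xi j) _; rewrite lerDr.
have -> : normc (c xi) * (2 * (t ^+ 2 * jbracket R xi ^+ 2)) * jbracket R xi ^+ k =
  2 * (normc (c xi) * jbracket R xi ^+ k.+2) * t ^+ 2 by rewrite -[k.+2]addn2 exprD; ring.
by rewrite ler_wpM2r ?sqr_ge0// ler_wpM2l.
Qed.

Lemma fourier_sum_lipschitz c A x v : coef_bound N.*2.+2 A c ->
  normc (fourier_sum c (x + v) - fourier_sum c x) <=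
  2 * (2 * N%:R * A) * 3 ^+ N * `|v|.
Proof.
move=> cA; have cA' := coef_boundW (leqnSn _) cA.
rewrite fourier_sum_shift -(fourier_sumB x (coef_bound_expi v cA') cA').
apply: le_trans (normc_fourier_sum_le x (coef_bound_lipschitz v cA)) _.
by rewrite le_eqVlt; apply/orP; left; apply/eqP; ring.
Qed.

Lemma fourier_sum_taylor c A x j (t : R) : coef_bound N.*2.+3 A c ->
  normc (fourier_sum c (x + t *: delta_mx 0 j) - fourier_sum c x -
         t%:C * fourier_sum (freq_mul j c) x) <=
  2 * (2 * A) * 3 ^+ N * t ^+ 2.
Proof.
move=> cA; have cA1 := coef_boundW (leqW (leqnSn _)) cA.
have cA2 := coef_boundW (leqnSn _) cA.
have cv := coef_bound_expi (t *: delta_mx 0 j) cA1.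
have cf := coef_bound_freq_mul j cA2.
rewrite fourier_sum_shift -(fourier_sumB x cv cA1) -(fourier_sumZ _ _ cf).
rewrite -(fourier_sumB x (coef_boundB cv cA1) (coef_boundZ _ cf)).
apply: le_trans (normc_fourier_sum_le x (coef_bound_taylor j t cA)) _.
by rewrite le_eqVlt; apply/orP; left; apply/eqP; ring.
Qed.

Lemma continuousC_fourier_sum c : rapid_decay c -> continuousC (fourier_sum c).
Proof.
move=> /(_ N.*2.+2)[A cA].
split; apply: (@continuous_lipschitz _ _ _ (2 * (2 * N%:R * A) * 3 ^+ N)) => x v.
  rewrite /re_part -ReB; apply: le_trans (normr_Re_le _) _.
  exact: fourier_sum_lipschitz.
rewrite /im_part -ImB; apply: le_trans (normr_Im_le _) _.
exact: fourier_sum_lipschitz.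
Qed.

Lemma is_derive_fourier_sum c x j : rapid_decay c ->
  is_derive x (delta_mx 0 j) (re_part (fourier_sum c))
    (complex.Re (fourier_sum (freq_mul j c) x)) /\
  is_derive x (delta_mx 0 j) (im_part (fourier_sum c))
    (complex.Im (fourier_sum (freq_mul j c) x)).
Proof.
move=> /(_ N.*2.+3)[A cA].
have tay t := fourier_sum_taylor x j t cA.
have ReZ (t : R) z : complex.Re (t%:C * z) = t * complex.Re z.
  by case: z => a b /=; rewrite mul0r subr0.
have ImZ (t : R) z : complex.Im (t%:C * z) = t * complex.Im z.
  by case: z => a b /=; rewrite mul0r addr0.
split; apply: (@is_derive_quadratic _ _ _ _ _ _ (2 * (2 * A) * 3 ^+ N)) => t.
  by rewrite /re_part -ReZ -!ReB; apply: le_trans (normr_Re_le _) _.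
by rewrite /im_part -ImZ -!ImB; apply: le_trans (normr_Im_le _) _.
Qed.

Lemma partial_fourier_sum c j : rapid_decay c ->
  partial j (fourier_sum c) = fourier_sum (freq_mul j c).
Proof.
move=> dc; apply/funext => x; have [r i] := is_derive_fourier_sum x j dc.
apply/eqP; rewrite eq_complex /partial /=.
by rewrite !derive_val !eqxx.
Qed.

Lemma rapid_decay_freq_mul j c : rapid_decay c -> rapid_decay (freq_mul j c).
Proof.
by move=> dc k; have [A cA] := dc k.+1; exists A; exact: coef_bound_freq_mul.
Qed.

Lemma smooth_fourier_sum c : rapid_decay c -> smooth (fourier_sum c).
Proof.
move=> dc s.
suff [d dd ->] : exists2 d, rapid_decay d &
    foldr (@partial R N) (fourier_sum c) s = fourier_sum d.
  split; first exact: continuousC_fourier_sum.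
  by move=> x j; have [] := is_derive_fourier_sum x j dd.
elim: s => [|j s [d dd E]] /=; first by exists c.
exists (freq_mul j d); first exact: rapid_decay_freq_mul.
by rewrite E partial_fourier_sum.
Qed.

Lemma expi_2pi_int (m : int) : expi (2 * pi * m%:~R) = 1 :> R[i].
Proof.
have nat_case (n : nat) : expi (2 * pi * n%:R) = 1 :> R[i].
  elim: n => [|n IH]; first by rewrite mulr0 expi0.
  rewrite -[n.+1%:R]natr1 mulrDr mulr1 expiD IH mul1r /expi.
  by rewrite mulr_natl cos2pi sin2pi.
case: m => n; first exact: nat_case.
rewrite NegzE rmorphN mulrN.
by rewrite -[LHS]mulr1 -[X in _ * X](nat_case n.+1) -expiD addrC subrr expi0.
Qed.

Lemma periodic_fourier_sum c : Defs.periodic (fourier_sum c).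
Proof.
move=> x j; rewrite fourier_sum_shift; congr (fourier_sum _ x).
by apply/funext => xi; rewrite dotp_delta expi_2pi_int mulr1.
Qed.

Definition monomial (a : mindex N) xi : R[i] :=
  \prod_(j < N) ((xi 0 j)%:~R : R)%:C ^+ a j.

Lemma normc_coord_le xi j : normc ((xi 0 j)%:~R : R)%:C <= jbracket R xi.
Proof.
rewrite normc_real; apply: le_trans (normr_coord_le_eucl R xi j) _.
by rewrite lerDr.
Qed.

Lemma normc_prod_coord_le (a : mindex N) s xi :
  normc (\prod_(j <- s) ((xi 0 j)%:~R : R)%:C ^+ a j) <=
  jbracket R xi ^+ (\sum_(j <- s) a j).
Proof.
elim: s => [|j s IH]; first by rewrite !big_nil normc1 expr0.
rewrite !big_cons normcM normcX exprD.
apply: ler_pM; rewrite ?exprn_ge0 ?normc_ge0//.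
by rewrite lerXn2r ?nnegrE ?normc_ge0 ?normc_coord_le// ltW// jbracket_gt0.
Qed.

Lemma coef_boundM n k A c (d : 'rV[int]_N -> R[i]) :
  (forall xi, normc (d xi) <= jbracket R xi ^+ n) ->
  coef_bound (n + k) A c -> coef_bound k A (fun xi => d xi * c xi).
Proof.
move=> dn cA xi; apply: le_trans (cA xi); rewrite normcM exprD mulrA.
rewrite ler_wpM2r ?exprn_ge0 ?(ltW (jbracket_gt0 _ _))// mulrC.
by rewrite ler_wpM2l ?normc_ge0.
Qed.

Lemma rapid_decayM n c (d : 'rV[int]_N -> R[i]) :
  (forall xi, normc (d xi) <= jbracket R xi ^+ n) ->
  rapid_decay c -> rapid_decay (fun xi => d xi * c xi).
Proof.
by move=> dn dc k; have [A cA] := dc (n + k)%N; exists A; exact: coef_boundM cA.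
Qed.

Lemma Dop_fourier_sum c j : rapid_decay c ->
  Dop j (fourier_sum c) = fourier_sum (fun xi => ((xi 0 j)%:~R : R)%:C * c xi).
Proof.
move=> dc; apply/funext => x; rewrite /Dop partial_fourier_sum//.
have [A cA] := rapid_decay_freq_mul j dc (N.*2.+1).
rewrite -(fourier_sumZ _ _ cA); congr (fourier_sum _ x); apply/funext => xi.
rewrite /freq_mul mulrA; congr (_ * _).
apply/eqP; rewrite eq_complex /=.
by rewrite !(mulr0, mul0r, mulNr, mul1r, oppr0, sub0r, addr0, add0r, opprK) !eqxx.
Qed.

Lemma iter_Dop_fourier_sum c j n : rapid_decay c ->
  iter n (Dop j) (fourier_sum c) =
  fourier_sum (fun xi => ((xi 0 j)%:~R : R)%:C ^+ n * c xi).
Proof.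
move=> dc; elim: n => [|n IH].
  by congr fourier_sum; apply/funext => xi; rewrite expr0 mul1r.
rewrite iterS IH Dop_fourier_sum.
  by congr fourier_sum; apply/funext => xi; rewrite mulrA -exprS.
apply: (rapid_decayM (n := n)) dc => xi.
by rewrite normcX lerXn2r ?nnegrE ?normc_ge0 ?normc_coord_le// ltW// jbracket_gt0.
Qed.

Lemma normc_monomial_le a xi : normc (monomial a xi) <= jbracket R xi ^+ mdeg a.
Proof. exact: normc_prod_coord_le. Qed.

Lemma Dmulti_fourier_sum c a : rapid_decay c ->
  Dmulti a (fourier_sum c) = fourier_sum (fun xi => monomial a xi * c xi).
Proof.
move=> dc; rewrite /Dmulti.
have -> : monomial a = fun xi => \prod_(j <- enum 'I_N) ((xi 0 j)%:~R : R)%:C ^+ a j.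
  by apply/funext => xi; rewrite /monomial big_enum.
elim: (enum 'I_N) => [|j s IH] /=.
  by congr fourier_sum; apply/funext => xi; rewrite big_nil mul1r.
rewrite IH iter_Dop_fourier_sum.
  by congr fourier_sum; apply/funext => xi; rewrite big_cons mulrA.
apply: (rapid_decayM (n := \sum_(i <- s) a i)) dc => xi.
exact: normc_prod_coord_le.
Qed.

End smoothness.

(** * Coefficients controlled by a weight sequence *)

(** A binomial coefficient is one of the terms of (1 + 1)^(m + n). *)
Lemma factD_le (m n : nat) : ((m + n)`! <= 2 ^ (m + n) * (m`! * n`!))%N.
Proof.
rewrite -(bin_fact (leq_addr n m)) addKn leq_mul2r; apply/orP; right.
rewrite -[2%N]/(1 + 1)%N expnDn.
have mi : (m < (m + n).+1)%N by rewrite ltnS leq_addr.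
rewrite (bigD1 (Ordinal mi)) //= !exp1n !muln1.
exact: leq_addr.
Qed.

Section ultradifferentiable.
Variables (R : realType) (N : nat) (M : weight_sequence R).
Implicit Types (c : 'rV[int]_N -> R[i]) (A h : R).

(** Differentiating k times brings down at most k powers of |xi|; this bounds
    what remains, with q powers to spare, by the size A h^k m_k k! that the
    Denjoy-Carleman class allows. *)
Definition weight_decay q A h c : Prop :=
  forall k, coef_bound (k + q) (A * (h ^+ k * M k * k`!%:R)) c.

(** The infimum is at most its term of index k + q.  There m_(k+q) is at most
    H^(k+q) m_k m_q and (k+q)! at most 2^(k+q) k! q!; the factors indexed by q go
    into A and the others give h = 2 H / delta. *)
Lemma weight_decay_of_inf q c (C delta : R) : 0 <= C -> 0 < delta ->
  (forall xi, normc (c xi) <=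
     C * inf (range (fun n : nat =>
           M n * n`!%:R / (delta ^+ n * (1 + eucl R xi) ^+ n)))) ->
  exists A h, [/\ 0 <= A, 0 < h & weight_decay q A h c].
Proof.
move=> C0 d0 cC; have [H H1 MH] := ws_stable M.
have H0 : 0 < H by exact: lt_trans H1.
have base n : coef_bound n (C * (M n * n`!%:R / delta ^+ n)) c.
  move=> xi; rewrite -ler_pdivlMr ?exprn_gt0 ?jbracket_gt0//.
  apply: le_trans (cC xi) _; rewrite -!mulrA ler_wpM2l// !mulrA -mulrA -invfM.
  apply: ge_inf; last by exists n => //=; rewrite mulrA.
  exists 0 => _ [m _ <-]; rewrite divr_ge0// mulr_ge0 ?exprn_ge0 ?(ltW d0)//.
    exact/ltW/ws_gt0.
  by rewrite addr_ge0 ?eucl_ge0.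
exists (C * ((2 * H / delta) ^+ q * M q * q`!%:R)), (2 * H / delta); split.
- have Mq := ltW (ws_gt0 M q).
  by rewrite !mulr_ge0 ?exprn_ge0 ?divr_ge0 ?mulr_ge0 ?(ltW H0) ?(ltW d0).
- by rewrite divr_gt0 ?mulr_gt0.
move=> k xi; apply: le_trans (base _ xi) _.
rewrite -[leRHS]mulrA ler_wpM2l//.
apply: (@le_trans _ _ (H ^+ (k + q) * M k * M q *
    (2 ^+ (k + q) * (k`!%:R * q`!%:R)) / delta ^+ (k + q))).
  rewrite ler_wpM2r ?invr_ge0 ?exprn_ge0 ?(ltW d0)//; apply: ler_pM => //.
    exact/ltW/ws_gt0.
  by rewrite -!natrM -natrX -natrM ler_nat factD_le.
rewrite le_eqVlt; apply/orP; left; apply/eqP.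
rewrite !expr_div_n !exprMn !exprD.
by field; rewrite !expf_neq0 ?gt_eqF.
Qed.

Lemma weight_decay_rapid q A h c : weight_decay q A h c -> rapid_decay c.
Proof.
by move=> cA k; eexists; apply: coef_boundW (cA k); exact: leq_addr.
Qed.

Lemma normc_Dmulti_fourier_sum_le A h c (a : mindex N) x :
  weight_decay N.*2.+1 A h c ->
  normc (Dmulti a (fourier_sum c) x) <=
  2 * A * 3 ^+ N * (h ^+ mdeg a * M (mdeg a) * (mdeg a)`!%:R).
Proof.
move=> cA; rewrite (Dmulti_fourier_sum _ (weight_decay_rapid cA)).
apply: le_trans (normc_fourier_sum_le x (coef_boundM (normc_monomial_le R a) (cA _))) _.
by rewrite le_eqVlt; apply/orP; left; apply/eqP; ring.
Qed.

Lemma DC_fourier_sum A h c : 0 < h -> weight_decay N.*2.+1 A h c ->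
  fourier_sum c \in DC_pred M.
Proof.
move=> h0 cA; apply/asboolP; split.
- exact: periodic_fourier_sum.
- exact/smooth_fourier_sum/(weight_decay_rapid cA).
have W0 (a : mindex N) : 0 < h ^+ mdeg a * M (mdeg a) * (mdeg a)`!%:R.
  by rewrite !mulr_gt0 ?exprn_gt0 ?ws_gt0// ltr0n fact_gt0.
(* the absolute value and the +1 make the constant positive *)
exists (`|2 * A * 3 ^+ N| + 1), h; split=> // x a.
apply: le_trans (normc_Dmulti_fourier_sum_le a x cA) _.
rewrite -2![leRHS]mulrA ![X in _ <= _ * X]mulrA ler_wpM2r ?(ltW (W0 a))//.
by apply: le_trans (ler_norm _) _; rewrite lerDl.
Qed.

Lemma DC_norm_fourier_sum_le A h c (u : DC N M) : 0 < h ->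
  weight_decay N.*2.+1 A h c -> (u : 'rV[R]_N -> R[i]) = fourier_sum c ->
  (DC_norm h u <= (2 * A * 3 ^+ N)%:E)%E.
Proof.
move=> h0 cA uc; apply: ge_ereal_sup => _ [x [a ->]].
rewrite lee_fin ler_pdivrMr; last first.
  by rewrite !mulr_gt0 ?exprn_gt0 ?ws_gt0// ltr0n fact_gt0.
by rewrite uc; exact: normc_Dmulti_fourier_sum_le.
Qed.

Lemma weight_decay_truncate q A h j c :
  weight_decay q A h c -> weight_decay q A h (truncate j c).
Proof. by move=> cA k; exact: coef_bound_truncate. Qed.

(** The rate 1 / (1 + j) is uniform in k, hence survives the supremum over all
    derivatives in the norm of E_h. *)
Lemma weight_decay_tail q A h j c :
  weight_decay q.+1 A h c -> weight_decay q (A / j.+1%:R) h (truncate j c \- c).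
Proof.
move=> cA k; rewrite mulrAC; apply: coef_bound_tail.
by rewrite -addnS; exact: cA.
Qed.

Lemma weight_decayW q q' A h c : (q <= q')%N -> weight_decay q' A h c ->
  weight_decay q A h c.
Proof. by move=> qq' cA k; apply: coef_boundW (cA k); rewrite leq_add2l. Qed.

(** A neighbourhood of 0 in the inductive limit contains a ball of E_h for the
    one h at hand, and the partial sums converge in the norm of that space. *)
Lemma fourier_cvg_DC_sum A h c (psi : DC N M) : 0 < h ->
  weight_decay N.*2.+2 A h c -> (psi : 'rV[R]_N -> R[i]) = fourier_sum c ->
  fourier_cvg_DC c psi.
Proof.
move=> h0 cA psiE; have cA1 := weight_decayW (leqnSn _) cA.
have cb := cA1 0%N.
pose S j : DC N M := MkDC (DC_fourier_sum h0 (weight_decay_truncate j cA1)).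
exists S; split=> [j x|].
  exact: fourier_sum_truncate cb.
have SE j : (S j - psi : 'rV[R]_N -> R[i]) = fourier_sum (truncate j c \- c).
  apply/funext => x.
  by rewrite (fourier_sumB x (coef_bound_truncate j cb) cb) -psiE.
move=> U /DC_nbhsE[V [_ bV] VU].
have [r r0 BV] := bV h h0.
have /cvgrPdist_lt/(_ r r0)[n _ nP] := cvg_div_succ (2 * A * 3 ^+ N).
exists n => // j /= nj; apply/VU/BV.
rewrite /DC_ball /=.
have /= := DC_norm_fourier_sum_le h0 (weight_decay_tail j cA) (SE j).
move/le_lt_trans; apply; rewrite lte_fin.
have := nP j nj; rewrite sub0r normrN; apply: le_lt_trans.
by apply: le_trans (ler_norm _); rewrite mulrA mulrAC.
Qed.

Lemma cvgC_complex (u : nat -> R[i]) (z : R[i]) : cvgC u z ->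
  (u j : R[i]^o) @[j --> \oo] --> (z : R[i]^o).
Proof.
move=> [r i]; apply/cvgrPdist_lt => e e0.
(* a positive element of R[i] is real *)
have eE : e = (complex.Re e)%:C.
  by case: e e0 => a b; rewrite ltcE /= => /andP[/eqP -> _].
have er : 0 < complex.Re e by move: e0; rewrite ltcE => /andP[].
have e2 : 0 < complex.Re e / 2 by rewrite divr_gt0.
near=> j.
have normE w : `|w| = (normc w)%:C :> R[i] by [].
rewrite eE normE ltcR; apply: le_lt_trans (normc_le_ReIm _) _.
rewrite ReB ImB (splitr (complex.Re e)); apply: ltrD; near: j.
  by have /cvgrPdist_lt/(_ _ e2) := r.
by have /cvgrPdist_lt/(_ _ e2) := i.
Unshelve. all: by end_near. Qed.

End ultradifferentiable.

(** * Integrals over the period box *)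

Section one_dimensional_integrals.
Variable R : realType.
Implicit Types (f F : R -> R) (a b : R) (m : int).

Lemma Rintegral_is_derive f F a b : a < b ->
  (forall x : R, is_derive x 1 F (f x)) -> continuous f ->
  \int[lebesgue_measure]_(x in `[a, b]) f x = F b - F a.
Proof.
move=> ab dF cf; rewrite /Rintegral (@continuous_FTC2 _ _ F)//.
- exact/continuous_subspaceT.
- have cF : continuous F.
    by move=> x; apply/differentiable_continuous/derivable1_diffP; exact: ex_derive.
  split=> [x _||]; first exact: ex_derive.
    by apply: cvg_at_right_filter; exact: cF.
  by apply: cvg_at_left_filter; exact: cF.
- by move=> x _; rewrite derive1E derive_val.
Qed.

Lemma Rintegral_cos_period m :
  \int[lebesgue_measure]_(x in `[0, 2 * pi]) cos (x * m%:~R) =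
  if m == 0 then 2 * pi else 0 :> R.
Proof.
have tp0 : 0 < 2 * pi :> R by rewrite mulr_gt0 ?pi_gt0.
have cc : continuous (fun x : R => cos (x * m%:~R)).
  by move=> x; apply: (@cvg_comp _ _ _ (fun x => x * m%:~R) (@cos R));
     [apply: cvgMl; exact: cvg_id|exact: continuous_cos].
case: eqVneq => [m0|m0].
  have d (x : R) : is_derive x 1 id (cos (x * m%:~R)).
    by rewrite m0 mulr0 cos0; exact: is_derive_id.
  by rewrite (Rintegral_is_derive tp0 d cc) subr0.
have m0' : m%:~R != 0 :> R by rewrite intr_eq0.
have d (x : R) :
    is_derive x 1 (fun x => (m%:~R)^-1 * sin (x * m%:~R)) (cos (x * m%:~R)).
  apply: is_derive_eq.
  by rewrite /GRing.scale/=; field.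
rewrite (Rintegral_is_derive tp0 d cc).
by have [_ ->] := expi_2pi_int R m; rewrite mul0r sin0 subrr.
Qed.

Lemma Rintegral_sin_period m :
  \int[lebesgue_measure]_(x in `[0, 2 * pi]) sin (x * m%:~R) = 0 :> R.
Proof.
have tp0 : 0 < 2 * pi :> R by rewrite mulr_gt0 ?pi_gt0.
have [->|m0] := eqVneq m 0.
  under eq_Rintegral do rewrite mulr0 sin0.
  by rewrite Rintegral_cst// mul0r.
have cs : continuous (fun x : R => sin (x * m%:~R)).
  by move=> x; apply: (@cvg_comp _ _ _ (fun x => x * m%:~R) (@sin R));
     [apply: cvgMl; exact: cvg_id|exact: continuous_sin].
have m0' : m%:~R != 0 :> R by rewrite intr_eq0.
have d (x : R) :
    is_derive x 1 (fun x => - (m%:~R)^-1 * cos (x * m%:~R)) (sin (x * m%:~R)).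
  apply: is_derive_eq.
  by rewrite /GRing.scale/=; field.
rewrite (Rintegral_is_derive tp0 d cs).
by have [-> _] := expi_2pi_int R m; rewrite mul0r cos0 subrr.
Qed.

End one_dimensional_integrals.

Section box_integrals.
Variable R : realType.
Local Notation RM := (measurableTypeR R).
Local Notation period := `[0, 2 * pi]%classic.

Lemma measurable_torus_box n : measurable (@torus_box R n).
Proof.
have -> : @torus_box R n =
    \bigcap_(j in [set: 'I_n]) ((fun t : n.-tuple RM => tnth t j) @^-1` period).
  apply/seteqP; split=> [t tb j _|t tb j]; first by rewrite /= in_itv; exact: tb.
  by have := tb j I; rewrite /= in_itv.
apply: fin_bigcap_measurable => // j _.
rewrite -[X in measurable X]setTI; apply: measurable_tnth => //.
Qed.

Lemma tuple_cons_torus_box n :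
  @tuple_cons R n @^-1` (@torus_box R n.+1) = period `*` (@torus_box R n).
Proof.
apply/seteqP; split=> [[x t] tb|[x t] [/= xp tb] j].
  split=> /=; first by have := tb ord0; rewrite (tnth_nth 0) /= in_itv.
  by move=> j; have := tb (lift ord0 j); rewrite !(tnth_nth 0).
case: (unliftP ord0 j) => [i|] ->; last by move: xp; rewrite (tnth_nth 0) /= in_itv.
by have := tb i; rewrite !(tnth_nth 0).
Qed.

Lemma lebesgue_measure_period : lebesgue_measure (period : set R) = (2 * pi)%:E.
Proof.
by rewrite lebesgue_measure_itv /= lte_fin mulr_gt0 ?pi_gt0// oppr0 adde0.
Qed.

Lemma lebesgueN_torus_box n : lebesgueN R n (@torus_box R n) = ((2 * pi) ^+ n)%:E.
Proof.
have tp0 : 0 < 2 * pi :> R by rewrite mulr_gt0 ?pi_gt0.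
elim: n => [|n IH].
  by rewrite /= diracE mem_set// => -[].
rewrite /= /lebesgue_cons /pushforward tuple_cons_torus_box product_measure1E//.
  by rewrite IH [X in (X * _)%E]lebesgue_measure_period -EFinM exprS.
exact: measurable_torus_box.
Qed.

Lemma bounded_integrable d (T : measurableType d) (mu : {measure set T -> \bar R})
    (D : set T) (f : T -> R) (K : R) :
  measurable D -> (mu D < +oo)%E -> measurable_fun setT f ->
  (forall t, `|f t| <= K) -> mu.-integrable D (EFin \o f).
Proof.
move=> mD Dfin mf fK; apply: measurable_bounded_integrable => //.
  exact: measurable_funTS.
by exists K; split; [exact: num_real|move=> y Ky t _; exact: le_trans (ltW Ky)].
Qed.

Lemma integrable_torus_box n (f : n.-tuple RM -> R) (K : R) :
  measurable_fun setT f -> (forall t, `|f t| <= K) ->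
  (lebesgueN R n).-integrable (@torus_box R n) (EFin \o f).
Proof.
apply: bounded_integrable; first exact: measurable_torus_box.
by rewrite [X in (X < _)%E]lebesgueN_torus_box ltry.
Qed.

Lemma measurable_head_behead n (u : RM -> R) (v : n.-tuple RM -> R) :
  measurable_fun setT u -> measurable_fun setT v ->
  measurable_fun setT (fun t : n.+1.-tuple RM => u (thead t) * v [tuple of behead t]).
Proof.
move=> mu mv; apply: measurable_funM; apply: measurableT_comp => //.
  exact: measurable_tnth.
exact: measurable_behead.
Qed.

(** The (n+1)-dimensional measure is the image of a product measure under
    [tuple_cons], so Fubini separates the first coordinate from the others. *)
Lemma Rintegral_box_prod n (u : RM -> R) (v : n.-tuple RM -> R) :
  measurable_fun setT u -> measurable_fun setT v ->
  (forall x, `|u x| <= 1) -> (forall t, `|v t| <= 1) ->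
  \int[lebesgueN R n.+1]_(t in @torus_box R n.+1) (u (thead t) * v [tuple of behead t]) =
  (\int[lebesgue_measure]_(x in period) u x) *
  (\int[lebesgueN R n]_(t in @torus_box R n) v t).
Proof.
move=> mu mv u1 v1.
pose f t := u (thead t) * v [tuple of behead t].
have mf : measurable_fun [set: n.+1.-tuple RM] f by exact: measurable_head_behead.
have f1 t : `|f t| <= 1 by rewrite normrM mulr_ile1.
have If := integrable_torus_box mf f1.
have mper : measurable (period : set RM) by exact: measurable_itv.
have mbox := @measurable_torus_box n.
have mprod := measurableX mper mbox.
pose g (z : RM * n.-tuple RM) : \bar R := (u z.1 * v z.2)%:E.
have fg : (EFin \o f) \o @tuple_cons R n = g.
  apply/funext => -[x t]; rewrite /g /f /=; congr (_ * v _)%:E.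
  by apply: val_inj.
have Ig : (lebesgue_measure \x lebesgueN R n)%E.-integrable
    (period `*` @torus_box R n) g.
  have mg : measurable_fun [set: RM * n.-tuple RM] (fun z => u z.1 * v z.2).
    by apply: measurable_funM; apply: measurableT_comp.
  apply: (bounded_integrable (K := 1) mprod _ mg) => [|z].
    have mP : (lebesgue_measure \x lebesgueN R n)%E (period `*` @torus_box R n) =
        (2 * pi * (2 * pi) ^+ n)%:E.
      rewrite product_measure1E// [X in (X * _)%E]lebesgue_measure_period.
      by rewrite [X in (_ * X)%E]lebesgueN_torus_box.
    by rewrite [X in (X < _)%E]mP ltry.
  by rewrite normrM mulr_ile1.
rewrite /Rintegral -[X in fine X = _]/(integral _ _ (EFin \o f)) /=.
rewrite integral_pushforward//; last 4 first.
- exact: measurable_tuple_cons.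
- exact/measurable_EFinP.
- by rewrite tuple_cons_torus_box fg.
- exact: measurable_torus_box.
rewrite tuple_cons_torus_box fg integral_mkcond.
rewrite -integral12_prod_meas1; last by apply/(integrable_mkcond _ mprod).
have Iv := integrable_torus_box mv v1.
have Iu : lebesgue_measure.-integrable period (EFin \o u).
  apply: (bounded_integrable (K := 1)) => //.
  by rewrite [X in (X < _)%E]lebesgue_measure_period ltry.
pose Iv' := (\int[lebesgueN R n]_(t in @torus_box R n) (v t)%:E)%E.
transitivity (fine (\int[lebesgue_measure]_x (Iv' * ((EFin \o u) \_ period) x))%E).
  congr fine; apply: eq_integral => x _; rewrite /fubini_F.
  transitivity (\int[lebesgueN R n]_(t in @torus_box R n)
    (((u \_ period) x)%:E * (v t)%:E))%E.
    rewrite [RHS]integral_mkcond; apply: eq_integral => t _.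
    rewrite !patchE in_setX /=; case: (t \in _); rewrite ?andbF// andbT.
    by case: (x \in _); rewrite ?mul0e.
  rewrite integralZl// muleC; congr (_ * _)%E.
  by rewrite !patchE /=; case: (x \in _).
have fIv : Iv' \is a fin_num by exact: integrable_fin_num.
rewrite -(fineK fIv) integralZl//; last by apply/(integrable_mkcond _ mper).
by rewrite -integral_mkcond fineM ?integrable_fin_num// mulrC.
Qed.

End box_integrals.

(** * Orthogonality of characters *)

Section characters.
Variable R : realType.
Local Notation RM := (measurableTypeR R).
Local Notation tup n := (n.-tuple RM).

Lemma dotp_tuple_row_cons n (t : tup n.+1) (eta : 'rV[int]_n.+1) :
  dotp (tuple_row t) eta = (thead t : R) * (eta 0 0)%:~R +
    dotp (tuple_row [tuple of behead t]) (\row_j eta 0 (lift ord0 j)).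
Proof.
rewrite /dotp big_ord_recl mxE; congr (_ + _); apply: eq_bigr => j _.
rewrite !mxE tnth_behead; congr (tnth _ _ * _); apply: val_inj => /=.
by rewrite inordK ?ltnS ?ltn_ord.
Qed.

Lemma measurable_dotp n (eta : 'rV[int]_n) :
  measurable_fun setT (fun t : tup n => dotp (tuple_row t) eta).
Proof.
have E : (fun t : tup n => dotp (tuple_row t) eta) =
    fun t : tup n => \sum_(j <- enum 'I_n) (tnth t j : R) * (eta 0 j)%:~R.
  by apply/funext => t; rewrite /dotp big_enum; apply: eq_bigr => j _; rewrite mxE.
rewrite E; apply: measurable_sum => j; apply: measurable_funM => //.
exact: measurable_tnth.
Qed.

Lemma measurable_cos_dotp n (eta : 'rV[int]_n) :
  measurable_fun setT (fun t : tup n => cos (dotp (tuple_row t) eta)).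
Proof.
apply: measurableT_comp; last exact: measurable_dotp.
by apply: continuous_measurable_fun; exact: continuous_cos.
Qed.

Lemma measurable_sin_dotp n (eta : 'rV[int]_n) :
  measurable_fun setT (fun t : tup n => sin (dotp (tuple_row t) eta)).
Proof.
apply: measurableT_comp; last exact: measurable_dotp.
by apply: continuous_measurable_fun; exact: continuous_sin.
Qed.

(** Induction on the dimension: the addition formulas for cos and sin separate
    the first coordinate, and the one-dimensional sine integrals vanish.  Cosine
    and sine are treated together because each formula involves both. *)
Lemma Rintegral_character n (eta : 'rV[int]_n) :
  \int[lebesgueN R n]_(t in @torus_box R n) cos (dotp (tuple_row t) eta) =
    (if eta == 0 then (2 * pi) ^+ n else 0) /\
  \int[lebesgueN R n]_(t in @torus_box R n) sin (dotp (tuple_row t) eta) = 0.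
Proof.
elim: n eta => [|n IH] eta.
  have d0 t : dotp (tuple_row t) eta = 0 :> R by rewrite /dotp big_ord0.
  have -> : eta == 0 by apply/eqP/rowP => -[].
  split.
    under eq_Rintegral do rewrite d0 cos0.
    rewrite Rintegral_cst; last exact: measurable_torus_box.
    by rewrite [X in fine X]lebesgueN_torus_box mul1r.
  under eq_Rintegral do rewrite d0 sin0.
  by rewrite Rintegral_cst ?mul0r//; exact: measurable_torus_box.
pose eta' : 'rV[int]_n := \row_j eta 0 (lift ord0 j).
pose a (x : RM) : R := x * (eta 0 0)%:~R.
pose d (t : tup n) : R := dotp (tuple_row t) eta'.
have [IHc IHs] := IH eta'.
have ma : measurable_fun setT a by apply: measurable_funM.
have mca : measurable_fun setT (cos \o a).
  apply: measurableT_comp => //.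
  by apply: continuous_measurable_fun; exact: continuous_cos.
have msa : measurable_fun setT (sin \o a).
  apply: measurableT_comp => //.
  by apply: continuous_measurable_fun; exact: continuous_sin.
have mcd := measurable_cos_dotp eta'; have msd := measurable_sin_dotp eta'.
have ca1 x : `|(cos \o a) x| <= 1 by exact: cos_max.
have sa1 x : `|(sin \o a) x| <= 1 by exact: sin_max.
have cd1 t : `|cos (d t)| <= 1 by exact: cos_max.
have sd1 t : `|sin (d t)| <= 1 by exact: sin_max.
have prodI (u : RM -> R) (v : tup n -> R) : measurable_fun setT u ->
    measurable_fun setT v -> (forall x, `|u x| <= 1) -> (forall t, `|v t| <= 1) ->
    (lebesgueN R n.+1).-integrable (@torus_box R n.+1)
      (EFin \o (fun t => u (thead t) * v [tuple of behead t])).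
  move=> mu mv u1 v1; apply: (integrable_torus_box (K := 1)).
    exact: measurable_head_behead.
  by move=> t; rewrite normrM mulr_ile1.
have mb := @measurable_torus_box R n.+1.
have dE t : dotp (tuple_row t) eta = a (thead t) + d [tuple of behead t].
  exact: dotp_tuple_row_cons.
have eta0 : (eta == 0) = (eta 0 0 == 0) && (eta' == 0).
  apply/eqP/andP => [e|[/eqP e0 /eqP e']].
    by rewrite /eta' e; split; [rewrite mxE|apply/eqP/rowP => j; rewrite !mxE].
  apply/rowP => j; rewrite mxE; case: (unliftP ord0 j) => [i|] ->; last exact: e0.
  by have /rowP/(_ i) := e'; rewrite !mxE.
split.
  under eq_Rintegral do rewrite dE cosD.
  rewrite RintegralB//; [|exact: (prodI _ _ mca mcd ca1 cd1)
                         |exact: (prodI _ _ msa msd sa1 sd1)].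
  rewrite (Rintegral_box_prod mca mcd ca1 cd1) (Rintegral_box_prod msa msd sa1 sd1).
  rewrite [X in _ * X]IHc [X in _ - _ * X]IHs mulr0 subr0.
  rewrite [X in X * _]Rintegral_cos_period.
  by rewrite eta0; case: eqP => _; case: eqP => _ /=; rewrite ?mulr0 ?mul0r// -exprS.
under eq_Rintegral do rewrite dE sinD.
rewrite RintegralD//; [|exact: (prodI _ _ msa mcd sa1 cd1)
                       |exact: (prodI _ _ mca msd ca1 sd1)].
rewrite (Rintegral_box_prod msa mcd sa1 cd1) (Rintegral_box_prod mca msd ca1 sd1).
by rewrite [X in _ + _ * X]IHs mulr0 addr0 [X in X * _]Rintegral_sin_period mul0r.
Qed.

End characters.

Section torus_integrals.
Variables (R : realType) (N : nat).
Implicit Types (f g : 'rV[R]_N -> R[i]) (c : 'rV[int]_N -> R[i]) (xi eta : 'rV[int]_N).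
Local Notation RM := (measurableTypeR R).

(** The points of the box are tuples, which carry the product sigma-algebra, so
    measurability is asked of the composition with [tuple_row]. *)
Definition bounded_measurable f : Prop :=
  [/\ measurable_fun setT (fun t : N.-tuple RM => re_part f (tuple_row t)),
      measurable_fun setT (fun t : N.-tuple RM => im_part f (tuple_row t)) &
      exists K, forall x, normc (f x) <= K].

Lemma bounded_measurable_integrable f : bounded_measurable f ->
  (lebesgueN R N).-integrable (@torus_box R N)
     (EFin \o (fun t => re_part f (tuple_row t))) /\
  (lebesgueN R N).-integrable (@torus_box R N)
     (EFin \o (fun t => im_part f (tuple_row t))).
Proof.
move=> [mr mi [K fK]]; split; apply: (integrable_torus_box (K := K)) => // t.
  exact: le_trans (normr_Re_le _) (fK _).
exact: le_trans (normr_Im_le _) (fK _).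
Qed.

Lemma bounded_measurableD f g : bounded_measurable f -> bounded_measurable g ->
  bounded_measurable (fun x => f x + g x).
Proof.
move=> [mr mi [K fK]] [mr' mi' [L gL]]; split.
- by rewrite /re_part; under eq_fun do rewrite ReD; exact: measurable_funD.
- by rewrite /im_part; under eq_fun do rewrite ImD; exact: measurable_funD.
- by exists (K + L) => x; apply: le_trans (normcD _ _) _; exact: lerD.
Qed.

Lemma torus_integralD f g : bounded_measurable f -> bounded_measurable g ->
  torus_integral (fun x => f x + g x) = torus_integral f + torus_integral g.
Proof.
move=> /bounded_measurable_integrable[rf if_] /bounded_measurable_integrable[rg ig].
have mb := @measurable_torus_box R N.
apply/eqP; rewrite eq_complex /= /re_part /im_part.
under eq_Rintegral do rewrite ReD.
under [X in _ && (X == _)]eq_Rintegral do rewrite ImD.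
by rewrite !RintegralD// !eqxx.
Qed.

Lemma Re_expiM (z : R[i]) (t : R) :
  complex.Re (z * expi t) = complex.Re z * cos t - complex.Im z * sin t.
Proof. by case: z. Qed.

Lemma Im_expiM (z : R[i]) (t : R) :
  complex.Im (z * expi t) = complex.Re z * sin t + complex.Im z * cos t.
Proof. by case: z. Qed.

Lemma bounded_measurable_character (z : R[i]) eta :
  bounded_measurable (fun x => z * expi (dotp x eta)).
Proof.
have mc := @measurable_cos_dotp R N eta; have ms := @measurable_sin_dotp R N eta.
split.
- rewrite /re_part; under eq_fun do rewrite Re_expiM.
  by apply: measurable_funB; apply: measurable_funM.
- rewrite /im_part; under eq_fun do rewrite Im_expiM.
  by apply: measurable_funD; apply: measurable_funM.
- by exists (normc z) => x; rewrite normcM normc_expi mulr1.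
Qed.

Lemma torus_integral_character (z : R[i]) eta :
  torus_integral (fun x => z * expi (dotp x eta)) =
  if eta == 0 then ((2 * pi) ^+ N)%:C * z else 0.
Proof.
have mb := @measurable_torus_box R N.
have Ic : (lebesgueN R N).-integrable (@torus_box R N)
    (EFin \o (fun t => cos (dotp (tuple_row t) eta))).
  by apply: (integrable_torus_box (K := 1)) => [|t];
    [exact: measurable_cos_dotp|exact: cos_max].
have Is : (lebesgueN R N).-integrable (@torus_box R N)
    (EFin \o (fun t => sin (dotp (tuple_row t) eta))).
  by apply: (integrable_torus_box (K := 1)) => [|t];
    [exact: measurable_sin_dotp|exact: sin_max].
have [Jc Js] := Rintegral_character R eta.
have IZ (w : R) (f : N.-tuple RM -> R) :
    (lebesgueN R N).-integrable (@torus_box R N) (EFin \o f) ->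
    (lebesgueN R N).-integrable (@torus_box R N) (EFin \o (fun t => w * f t)).
  by move=> If; apply: (integrableZl mb _ If).
rewrite /torus_integral /re_part /im_part.
under eq_Rintegral do rewrite Re_expiM.
under [X in _ +i* X]eq_Rintegral do rewrite Im_expiM.
rewrite RintegralB ?RintegralD ?RintegralZl//; try exact: IZ.
rewrite Jc Js !mulr0 subr0 add0r; case: ifP => _; last by rewrite !mulr0.
case: z => a b; apply/eqP; rewrite eq_complex /= !mul0r subr0 addr0.
by rewrite ![_ * (_ ^+ N)]mulrC !eqxx.
Qed.

Lemma torus_integral_sum (I : Type) (s : seq I) (z : I -> R[i]) (eta : I -> 'rV[int]_N) :
  bounded_measurable (fun x => \sum_(i <- s) z i * expi (dotp x (eta i))) /\
  torus_integral (fun x => \sum_(i <- s) z i * expi (dotp x (eta i))) =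
  \sum_(i <- s) if eta i == 0 then ((2 * pi) ^+ N)%:C * z i else 0.
Proof.
elim: s => [|i s [IHb IHi]].
  have -> : (fun x : 'rV[R]_N => \sum_(i <- [::]) z i * expi (dotp x (eta i))) =
      (fun x => 0 * expi (dotp x 0)).
    by apply/funext => x; rewrite big_nil mul0r.
  split; first exact: bounded_measurable_character.
  by rewrite torus_integral_character eqxx mulr0 big_nil.
have -> : (fun x => \sum_(k <- i :: s) z k * expi (dotp x (eta k))) =
    (fun x => z i * expi (dotp x (eta i)) + \sum_(k <- s) z k * expi (dotp x (eta k))).
  by apply/funext => x; rewrite big_cons.
have bi := bounded_measurable_character (z i) (eta i).
split; first exact: bounded_measurableD.
by rewrite (torus_integralD bi IHb) torus_integral_character IHi big_cons.
Qed.

End torus_integrals.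

(** * Fourier coefficients of a trigonometric series *)

Section fourier_coefficients.
Variables (R : realType) (N : nat).
Implicit Types (f g : 'rV[R]_N -> R[i]) (c : 'rV[int]_N -> R[i]) (xi : 'rV[int]_N).
Local Notation RM := (measurableTypeR R).

Lemma normr_Rintegral_torus_boxB (u v : N.-tuple RM -> R) (K : R) :
  (lebesgueN R N).-integrable (@torus_box R N) (EFin \o u) ->
  (lebesgueN R N).-integrable (@torus_box R N) (EFin \o v) ->
  (forall t, `|u t - v t| <= K) ->
  `|\int[lebesgueN R N]_(t in @torus_box R N) u t -
    \int[lebesgueN R N]_(t in @torus_box R N) v t| <= K * (2 * pi) ^+ N.
Proof.
move=> Iu Iv uvK; have mb := @measurable_torus_box R N.
have Iuv : (lebesgueN R N).-integrable (@torus_box R N) (EFin \o (fun t => u t - v t)).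
  exact: (integrableB mb Iu Iv).
rewrite -RintegralB//; apply: le_trans (le_normr_Rintegral mb Iuv) _.
have -> : K * (2 * pi) ^+ N = \int[lebesgueN R N]_(t in @torus_box R N) K.
  by rewrite Rintegral_cst// [X in fine X]lebesgueN_torus_box.
apply: le_Rintegral => //.
  exact: (integrable_norm Iuv).
exact: (integrable_torus_box (K := `|K|)).
Qed.

Lemma torus_integral_dist f g (K : R) : bounded_measurable f -> bounded_measurable g ->
  (forall x, normc (f x - g x) <= K) ->
  `|complex.Re (torus_integral f) - complex.Re (torus_integral g)| <= K * (2 * pi) ^+ N /\
  `|complex.Im (torus_integral f) - complex.Im (torus_integral g)| <= K * (2 * pi) ^+ N.
Proof.
move=> /bounded_measurable_integrable[rf if_] /bounded_measurable_integrable[rg ig] fgK.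
split; apply: normr_Rintegral_torus_boxB => // t.
  by rewrite /re_part -ReB; exact: le_trans (normr_Re_le _) (fgK _).
by rewrite /im_part -ImB; exact: le_trans (normr_Im_le _) (fgK _).
Qed.

(** Multiplication by e^(-i x xi) moves the frequency xi to 0, the only one with
    a nonzero integral. *)
Lemma modulated_partial c j xi :
  (fun x : 'rV[R]_N => expi (- dotp x xi) * fourier_partial c j x) = fun x =>
  \sum_(p <- [seq p <- index_enum (cube N j) | eucl R (cube_pt p) <= j%:R])
    c (cube_pt p) * expi (dotp x (cube_pt p - xi)).
Proof.
apply/funext => x; rewrite (partial_cube _ _ (leqnn j)) mulr_sumr big_filter.
apply: eq_bigr => p _.
rewrite mulrCA -expiD; congr (_ * expi _).
rewrite /dotp -sumrN -big_split /=; apply: eq_bigr => k _.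
by rewrite [(_ - xi) 0 k]mxE [(- xi) 0 k]mxE rmorphB mulrBr addrC.
Qed.

Lemma bounded_measurable_modulated_partial c j xi :
  bounded_measurable (fun x : 'rV[R]_N => expi (- dotp x xi) * fourier_partial c j x).
Proof.
rewrite modulated_partial.
by case: (torus_integral_sum [seq p <- index_enum (cube N j) | eucl R (cube_pt p) <= j%:R]
   (fun p : cube N j => c (cube_pt p)) (fun p => cube_pt p - xi)).
Qed.

Lemma torus_integral_modulated_partial c j xi : eucl R xi <= j%:R ->
  torus_integral (fun x : 'rV[R]_N => expi (- dotp x xi) * fourier_partial c j x) =
  ((2 * pi) ^+ N)%:C * c xi.
Proof.
move=> xij; rewrite modulated_partial.
rewrite (torus_integral_sum _ (fun p : cube N j => c (cube_pt p)) (fun p => cube_pt p - xi)).2.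
rewrite big_filter.
have [p0 p0E] := ball_cube xij.
rewrite (bigD1 p0) ?p0E//= subrr eqxx big1 ?addr0// => p /andP[_ pp0].
by rewrite subr_eq0 -p0E (inj_eq (@cube_pt_inj N j)) (negbTE pp0).
Qed.

(** Measurability passes to the limit of the partial sums, which avoids
    comparing the Borel sets of row vectors with the product sigma-algebra. *)
Lemma bounded_measurable_modulated_sum c A xi : coef_bound N.*2.+1 A c ->
  bounded_measurable (fun x : 'rV[R]_N => expi (- dotp x xi) * fourier_sum c x).
Proof.
move=> cA.
have cv x : cvgC (fun j => expi (- dotp x xi) * fourier_partial c j x)
    (expi (- dotp x xi) * fourier_sum c x) by exact/cvgCZ/(fourier_sumP x cA).
have mp j := bounded_measurable_modulated_partial c j xi.
split.
- apply: measurable_fun_cvg => [j|t _]; first by have [m _ _] := mp j; exact: m.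
  exact: (cv (tuple_row t)).1.
- apply: measurable_fun_cvg => [j|t _]; first by have [_ m _] := mp j; exact: m.
  exact: (cv (tuple_row t)).2.
- exists (2 * A * 3 ^+ N) => x; rewrite normcM normc_expi mul1r.
  exact: normc_fourier_sum_le.
Qed.

(** Once j >= |xi|, the integral of e^(-i x xi) S_j is exactly (2 pi)^N c_xi; by
    uniform convergence it also differs from that of e^(-i x xi) F_c by O(1/j). *)
Lemma fourier_coef_fourier_sum c A xi : coef_bound N.*2.+1 A c ->
  fourier_coef (fourier_sum c : 'rV[R]_N -> R[i]) xi = c xi.
Proof.
move=> cA.
pose If := torus_integral (fun x : 'rV[R]_N => expi (- dotp x xi) * fourier_sum c x).
have tp0 : 0 < 2 * pi :> R by rewrite mulr_gt0 ?pi_gt0.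
have [n xin] : exists n : nat, eucl R xi <= n%:R.
  by exists (Num.bound (eucl R xi)); exact/ltW/archi_boundP/eucl_ge0.
(* 2 adds up the real and imaginary errors; (2 pi)^N is the measure of the box *)
pose K := 2 * (A * 3 ^+ N) * (2 * pi) ^+ N.
have dist j : (n <= j)%N ->
    `|complex.Re If - complex.Re (((2 * pi) ^+ N)%:C * c xi)| <= K / j.+1%:R /\
    `|complex.Im If - complex.Im (((2 * pi) ^+ N)%:C * c xi)| <= K / j.+1%:R.
  move=> nj; have xij : eucl R xi <= j%:R by rewrite (le_trans xin)// ler_nat.
  have -> : K / j.+1%:R = 2 * (A * 3 ^+ N / j.+1%:R) * (2 * pi) ^+ N by rewrite /K; ring.
  rewrite -(torus_integral_modulated_partial c xij).
  apply: torus_integral_dist => [||x].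
  - exact: bounded_measurable_modulated_sum cA.
  - exact: bounded_measurable_modulated_partial.
  rewrite -mulrBr normcM normc_expi mul1r; apply: le_trans (normc_le_ReIm _) _.
  rewrite ReB ImB mulr2n mulrDl mul1r; apply: lerD.
    exact: Re_fourier_sumB.
  exact: Im_fourier_sumB.
have IfE : If = ((2 * pi) ^+ N)%:C * c xi by exact: complex_eq_of_harmonic_bound dist.
rewrite /fourier_coef -/If IfE mulrA -rmorphM /= mulVf ?mul1r//.
by rewrite expf_neq0// gt_eqF.
Qed.

End fourier_coefficients.

Theorem theorem4p13 (R : realType) (M : weight_sequence R) (N : nat)
    (N_ge1 : (1 <= N)%N) (b : 'rV[int]_N -> R[i])
    (b_bound : exists C delta : R, [/\ 0 < C, 0 < delta &
       forall xi : 'rV[int]_N, normc (b xi) <=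
         C * inf (range (fun n : nat =>
           M n * n`!%:R / (delta ^+ n * (1 + eucl R xi) ^+ n)))]) :
  exists psi : DC N M,
    [/\ forall x : 'rV[R]_N, (fourier_partial b j x : R[i]^o) @[j --> \oo] --> (psi x : R[i]^o),
        fourier_cvg_DC b psi
      & forall xi : 'rV[int]_N, fourier_coef psi xi = b xi].
Proof.
have [C [delta [C0 d0 bC]]] := b_bound.
have [A [h [A0 h0 bA]]] := weight_decay_of_inf N.*2.+2 (ltW C0) d0 bC.
have bA1 := weight_decayW (leqnSn _) bA.
pose psi : DC N M := MkDC (DC_fourier_sum h0 bA1).
have psiE : (psi : 'rV[R]_N -> R[i]) = fourier_sum b by [].
exists psi; split=> [x||xi].
- exact/cvgC_complex/(fourier_sumP x (bA1 0%N)).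
- exact: fourier_cvg_DC_sum h0 bA psiE.
- by rewrite psiE; exact: fourier_coef_fourier_sum xi (bA1 0%N).
Qed.
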